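(* Let $H$ be a discrete commutative regular Fourier hypergroup with Haar measure $\lambda$ normalized so that $\lambda(e)=1$. Suppose that $H$ satisfies $(P_2)$, that $B(H\times H)=B_\lambda(H\times H)$, and that the set $\{\lambda(x):x\in H\}$ is finite, where $\lambda(x)=\lambda(\{x\})$. Then $A(H)$ is an amenable Banach algebra.
   Context: Hypergroups (in the sense of Jewett). Let $H$ be a locally compact Hausdorff space and $M(H)$ the space of bounded Radon measures on $H$; a point $x\in H$ is identified with its point mass. $H$ is a hypergroup if: (1) there is a product $(\mu,\nu)\mapsto\mu\cdot\nu$ making $M(H)$ an algebra (determined by $\mu\cdot\nu=\int\int x\cdot y\,d\mu(x)d\nu(y)$), such that $x\cdot y$ is a probability measure for all $x,y\in H$ and $(x,y)\mapsto x\cdot y$ is continuous from $H\times H$ to $(M(H),\sigma(M(H),C_b(H)))$; (2) there is $e\in H$ with $e\cdot\mu=\mu\cdot e=\mu$ for all $\mu$; (3) there is a homeomorphism $x\mapsto\tilde x$ of $H$ with $\tilde{\tilde x}=x$, $(x\cdot y)^{\sim}=\tilde y\cdot\tilde x$, and $e\in\operatorname{supp}(x\cdot y)$ iff $x=\tilde y$; (4) $\operatorname{supp}(x\cdot y)$ is compact and $(x,y)\mapsto\operatorname{supp}(x\cdot y)$ is continuous into the nonempty compact subsets of $H$ with the Michael topology (generated by the sets $\{K: K\cap U\neq\emptyset, K\subseteq V\}$, $U,V$ open). $H$ is commutative if $\mu\cdot\nu=\nu\cdot\mu$ for all $\mu,\nu\in M(H)$. Write $f(x\cdot y)=\int f\,d(x\cdot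 y)$. A discrete hypergroup has a left Haar measure $\lambda$; $dx$ denotes integration against $\lambda$ and $L^p(H)=L^p(H,\lambda)$. Convolution of functions: $(f\cdot_\lambda g)(x)=\int_H f(y)g(\tilde y\cdot x)\,dy$; $L^1(H)$ is a Banach $*$-algebra (for commutative $H$, $f^*(x)=\overline{f(\tilde x)}$). The product hypergroup $H\times H$ has convolution $(x_1,x_2)\cdot(y_1,y_2)=(x_1\cdot y_1)\otimes(x_2\cdot y_2)$ and the product Haar measure. Fourier spaces. The left regular representation on $L^2(H)$ is $\lambda(x)\xi(y)=\xi(\tilde x\cdot y)$, and $\lambda(f)\xi=f\cdot_\lambda\xi$ for $f\in L^1(H)$. $C^*_\lambda(H)$ is the norm closure of $\lambda(L^1(H))$ in $\mathcal B(L^2(H))$; $\mathrm{VN}(H)$ is the von Neumann algebra generated by $\{\lambda(x):x\in H\}$. $C^*(H)$ is the completion of $L^1(H)$ in the norm $\sup_\pi\|\pi(f)\|$ over all representations $\pi$ of the hypergroup $H$ (for discrete $H$: all nondegenerate $*$-representations of $L^1(H)$ on Hilbert spaces). $B(H):=C^*(H)^*$ and $B_\lambda(H):=C^*_\lambda(H)^*$, with elements identified with bounded continuous functions $u$ on $H$ via $\langle u,f\rangle=\int_H u(x)f(x)\,dx$, $f\in L^1(H)$; thus $B_\lambda(H)\subseteq B(H)$. With $\tilde\xi(x)=\overline{\xi(\tilde x)}$, the Fourier space $A(H)$ is the closed subspace of $B_\lambda(H)$ spanned by $\{\xi\cdot_\lambda\tilde\xi:\xi\in C_c(H)\}$. $H$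 is a regular Fourier hypergroup if $A(H)$ is a Banach algebra under pointwise multiplication. Property $(P_2)$: there is a net $(\xi_\alpha)$ in $L^2(H)$ with $\xi_\alpha\ge 0$, $\|\xi_\alpha\|_2=1$, such that $\|\lambda(x)\xi_\alpha-\xi_\alpha\|_2\to 0$ uniformly for $x$ in compact subsets of $H$ (for discrete $H$: for every $x\in H$). *)

(* Defs.v *)
From HB Require Import structures.
From mathcomp Require Import all_boot all_order all_algebra.
From mathcomp Require Import all_classical all_reals all_analysis.
From mathcomp Require Import complex.

Set Implicit Arguments.
Unset Strict Implicit.
Unset Printing Implicit Defensive.

Import Order.TTheory GRing.Theory Num.Theory.
Import numFieldNormedType.Exports.
Import ComplexField.Normc.

Local Open Scope classical_set_scope.
Local Open Scope ring_scope.
Local Open Scope complex_scope.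

(** A Jewett hypergroup whose underlying space is discrete.  [hconv x y z] is
    the mass that the probability measure x.y gives to {z}.  On a discrete
    space the bounded Radon measures are the absolutely summable families of
    point masses, so the algebra structure of M(H) is determined by the
    products of points; compact sets are the finite ones; and the continuity
    requirements (weak continuity of the product, continuity of the involution,
    Michael continuity of supports) are vacuous. *)
Record discreteHypergroup (R : realType) := DiscreteHypergroup {
  hcarrier :> choiceType;
  hconv : hcarrier -> hcarrier -> hcarrier -> R;
  hunit : hcarrier;
  hinv : hcarrier -> hcarrier;
  hconv_ge0 : forall x y z, 0 <= hconv x y z;
  hconv_fin : forall x y, finite_set [set z | hconv x y z != 0];
  hconv_sum1 : forall x y, \sum_(z \in [set: hcarrier]) hconv x y z = 1;
  hconvA : forall x y z t,
    \sum_(u \in [set: hcarrier]) hconv x y u * hconv u z t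
    = \sum_(u \in [set: hcarrier]) hconv y z u * hconv x u t;
  hconv1x : forall x y, hconv hunit x y = (y == x)%:R;
  hconvx1 : forall x y, hconv x hunit y = (y == x)%:R;
  hinvK : involutive hinv;
  hconvV : forall x y z, hconv x y (hinv z) = hconv (hinv y) (hinv x) z;
  hconv_unitP : forall x y, hconv x y hunit != 0 <-> x = hinv y
}.

Definition hcommutative (R : realType) (H : discreteHypergroup R) : Prop :=
  forall x y z : H, hconv x y z = hconv y x z.

Lemma fsum_pairM (R : idomainType) (I J : choiceType) (f : I -> R) (g : J -> R) :
  finite_set [set i | f i != 0] -> finite_set [set j | g j != 0] ->
  \sum_(p \in [set: I * J]) f p.1 * g p.2
  = (\sum_(i \in [set: I]) f i) * (\sum_(j \in [set: J]) g j).
Proof.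
move=> finf fing.
have widen (K : choiceType) (h : K -> R) :
    \sum_(k \in [set: K]) h k = \sum_(k \in [set k | h k != 0]) h k.
  apply/esym/fsbig_widen => // k [_] /=.
  by move/negP; rewrite negbK => /eqP.
rewrite (widen I) (widen J) mulr_fsuml.
under [RHS]eq_fsbigr do rewrite mulr_fsumr.
rewrite (pair_fsbig _ (fun i j => f i * g j)) //.
apply/esym/fsbig_widen => // -[i j] [_] /= /not_andP[] /negP; rewrite negbK => /eqP.
  by move=> ->; rewrite mul0r.
by move=> ->; rewrite mulr0.
Qed.

Section ProductHypergroup.
Variables (R : realType) (H K : discreteHypergroup R).

Let T : choiceType := (H * K)%type.
Let pconv (x y z : T) : R := hconv x.1 y.1 z.1 * hconv x.2 y.2 z.2.
Let punit : T := (hunit H, hunit K).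
Let pinv (x : T) : T := (hinv x.1, hinv x.2).

Let pconv_ge0 x y z : 0 <= pconv x y z.
Proof. by apply: mulr_ge0; exact: hconv_ge0. Qed.

Let pconv_fin x y : finite_set [set z | pconv x y z != 0].
Proof.
apply: (@sub_finite_set _ _ ([set z | hconv x.1 y.1 z != 0]
                         `*` [set z | hconv x.2 y.2 z != 0])).
  by move=> z /=; rewrite mulf_eq0 negb_or => /andP.
by apply: finite_setX; exact: hconv_fin.
Qed.

Let pconv_sum1 x y : \sum_(z \in [set: T]) pconv x y z = 1.
Proof.
by rewrite (fsum_pairM (hconv_fin _ _) (hconv_fin _ _)) !hconv_sum1 mulr1.
Qed.

Let finM (G : discreteHypergroup R) (x y : G) (h : G -> R) :
  finite_set [set u | hconv x y u * h u != 0].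
Proof.
apply: sub_finite_set (hconv_fin x y) => u /=.
by rewrite mulf_eq0 negb_or => /andP[].
Qed.

Let pconvA x y z t :
  \sum_(u \in [set: T]) pconv x y u * pconv u z t
  = \sum_(u \in [set: T]) pconv y z u * pconv x u t.
Proof.
under eq_fsbigr do rewrite mulrACA.
under [RHS]eq_fsbigr do rewrite mulrACA.
have E := fsum_pairM (finM x.1 y.1 (fun u => hconv u z.1 t.1))
                     (finM x.2 y.2 (fun u => hconv u z.2 t.2)).
have F := fsum_pairM (finM y.1 z.1 (fun u => hconv x.1 u t.1))
                     (finM y.2 z.2 (fun u => hconv x.2 u t.2)).
by rewrite [LHS]E [RHS]F !hconvA.
Qed.

Let pconv1x x y : pconv punit x y = (y == x)%:R.
Proof. by rewrite /pconv !hconv1x -natrM mulnb -xpair_eqE -!surjective_pairing. Qed.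

Let pconvx1 x y : pconv x punit y = (y == x)%:R.
Proof. by rewrite /pconv !hconvx1 -natrM mulnb -xpair_eqE -!surjective_pairing. Qed.

Let pinvK : involutive pinv.
Proof. by move=> [x y]; rewrite /pinv /= !hinvK. Qed.

Let pconvV x y z : pconv x y (pinv z) = pconv (pinv y) (pinv x) z.
Proof. by rewrite /pconv /= !hconvV. Qed.

Let pconv_unitP x y : pconv x y punit != 0 <-> x = pinv y.
Proof.
rewrite mulf_eq0 negb_or; split.
  case: x y => [x1 x2] [y1 y2] /= /andP[/hconv_unitP -> /hconv_unitP ->].
  by rewrite /pinv /=.
by move=> ->; apply/andP; split; apply/hconv_unitP.
Qed.

Definition prod_hypergroup : discreteHypergroup R :=
  DiscreteHypergroup pconv_ge0 pconv_fin pconv_sum1 pconvA pconv1x pconvx1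
    pinvK pconvV pconv_unitP.

End ProductHypergroup.

(** The sum of an absolutely summable complex family. *)
Definition csum (R : realType) (T : choiceType) (f : T -> R[i]) : R[i] :=
  let rsum (g : T -> R) :=
    fine (\esum_(x in [set: T]) (EFin \o g)^\+%E x)
    - fine (\esum_(x in [set: T]) (EFin \o g)^\-%E x) in
  rsum (fun x => complex.Re (f x)) +i* rsum (fun x => complex.Im (f x)).

Section HaarMeasure.
Variables (R : realType) (H : discreteHypergroup R).

(** Measures on H are given by their point masses; the last clause is the
    invariance x . lam = lam. *)
Definition left_haar (lam : H -> R) : Prop :=
  [/\ forall x, 0 <= lam x,
      exists x, lam x != 0
    & forall x z : H,
        \esum_(y in [set: H]) (lam y * hconv x y z)%:E = (lam z)%:E].

(** f(x . y), the integral of f against x . y. *)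
Definition hprod_eval (f : H -> R[i]) (x y : H) : R[i] :=
  \sum_(z \in [set: H]) (hconv x y z)%:C * f z.

Variable lam : H -> R.

Definition hint (f : H -> R[i]) : R[i] := csum (fun x => (lam x)%:C * f x).

Definition L1 (f : H -> R[i]) : Prop :=
  (\esum_(x in [set: H]) (lam x * normc (f x))%:E < +oo)%E.

Definition L2 (f : H -> R[i]) : Prop :=
  (\esum_(x in [set: H]) (lam x * normc (f x) ^+ 2)%:E < +oo)%E.

Definition norm2 (f : H -> R[i]) : R :=
  Num.sqrt (fine (\esum_(x in [set: H]) (lam x * normc (f x) ^+ 2)%:E)).

Definition fconv (f g : H -> R[i]) (x : H) : R[i] :=
  hint (fun y => f y * hprod_eval g (hinv y) x).

(** conj (f (x~)); this is the operation xi |-> xi~ on L^2(H) and, when H is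
    commutative, also the involution of L^1(H). *)
Definition fstar (f : H -> R[i]) (x : H) : R[i] := (f (hinv x))^*%C.

(** The operator lambda(x) on functions. *)
Definition ltrans (x : H) (f : H -> R[i]) (y : H) : R[i] :=
  hprod_eval f (hinv x) y.

Definition property_P2 : Prop :=
  exists (I : Type) (le : I -> I -> Prop) (xi : I -> H -> R[i]),
  [/\ inhabited I,
      (forall i, le i i) /\ (forall i j k, le i j -> le j k -> le i k),
      forall i j, exists k, le i k /\ le j k,
      forall i, [/\ forall y, 0 <= xi i y, L2 (xi i) & norm2 (xi i) = 1]
    & forall (x : H) (eps : R), 0 < eps ->
        exists i0, forall i, le i0 i -> norm2 (ltrans x (xi i) - xi i) < eps].

End HaarMeasure.

Definition prod_haar (R : realType) (H K : discreteHypergroup R)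
    (lam : H -> R) (mu : K -> R) : prod_hypergroup H K -> R :=
  fun x => lam x.1 * mu x.2.

Record hilbertSpace (R : realType) := HilbertSpace {
  hilb :> completeNormedModType R[i];
  hdot : {dot hilb for (@Num.conj R[i])};
  hdotE : forall v : hilb, hdot v v = `|v| ^+ 2
}.

Section FourierSpaces.
Variables (R : realType) (H : discreteHypergroup R) (lam : H -> R).
Local Notation C := R[i].

(** Nondegenerate *-representations of the *-algebra L^1(H), for commutative H
    (see [fstar]).  [pi] is total; only its values on L^1(H) matter. *)
Record star_rep (K : hilbertSpace R) (pi : (H -> C) -> K -> K) : Prop :=
  StarRep {
  star_rep_op_linear : forall f, L1 lam f -> linear (pi f);
  star_rep_op_bounded : forall f, L1 lam f ->
    exists M : C, forall v, `|pi f v| <= M * `|v|;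
  star_rep_linear : forall (c : C) f g, L1 lam f -> L1 lam g ->
    forall v, pi (c *: f + g) v = c *: pi f v + pi g v;
  star_rep_mul : forall f g, L1 lam f -> L1 lam g ->
    forall v, pi (fconv lam f g) v = pi f (pi g v);
  star_rep_adj : forall f, L1 lam f ->
    forall v w, hdot K (pi f v) w = hdot K v (pi (fstar f) w);
  star_rep_nondegenerate : closure
    [set v : K | exists n (f : 'I_n -> H -> C) (w : 'I_n -> K),
       (forall i, L1 lam (f i)) /\ v = \sum_(i < n) pi (f i) (w i)] = setT
}.

Local Open Scope ereal_scope.

(** The norm of C*(H) on L^1(H). *)
Definition full_norm (f : H -> C) : \bar R :=
  ereal_sup [set e | exists (K : hilbertSpace R) (pi : (H -> C) -> K -> K),
    star_rep pi /\
    e = ereal_sup [set (complex.Re `|pi f v|)%:E | v in [set v : K | (`|v| <= 1)%R]]].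

(** The norm of C*_lambda(H) on L^1(H): the operator norm of lambda(f). *)
Definition reduced_norm (f : H -> C) : \bar R :=
  ereal_sup [set (norm2 lam (fconv lam f xi))%:E |
             xi in [set xi | L2 lam xi /\ (norm2 lam xi <= 1)%R]].

(** The dual of the completion of L^1(H) for a seminorm [p], as a space of
    bounded functions through <u, f> = \int u f, and its norm. *)
Definition dual_norm (p : (H -> C) -> \bar R) (u : H -> C) : \bar R :=
  ereal_sup [set (normc (hint lam (u * f)%R))%:E |
             f in [set f | L1 lam f /\ p f <= 1]].

Definition dual_space (p : (H -> C) -> \bar R) : set (H -> C) :=
  [set u | (exists M : R, forall x, (normc (u x) <= M)%R) /\
           dual_norm p u < +oo].

Definition B_space : set (H -> C) := dual_space full_norm.

Definition Blam_space : set (H -> C) := dual_space reduced_norm.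

Definition Blam_norm (u : H -> C) : R := fine (dual_norm reduced_norm u).

Definition A_span : set (H -> C) :=
  [set u | exists n (c : 'I_n -> C) (xi : 'I_n -> H -> C),
     (forall i, finite_set [set x | (xi i x != 0)%R]) /\
     u = (\sum_(i < n) c i *: fconv lam (xi i) (fstar (xi i)))%R].

Definition A_space : set (H -> C) :=
  [set u | Blam_space u /\ forall eps : R, (0 < eps)%R ->
     exists v, A_span v /\ (Blam_norm (u - v) < eps)%R].

End FourierSpaces.

(** Banach algebras of complex functions on T: the elements are the functions
    in [A], the operations are pointwise and the norm is [N]; [N] and, below,
    module actions and derivations only matter on [A].  Such an algebra need
    not have a unit. *)
Section BanachAlgebra.
Variables (R : realType) (T : Type).
Local Notation C := R[i].
Variables (A : set (T -> C)) (N : (T -> C) -> R).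

Record banach_algebra : Prop := BanachAlgebra {
  balg0 : A 0;
  balg_linear : forall (c : C) a b, A a -> A b -> A (c *: a + b);
  balg_mul : forall a b, A a -> A b -> A (a * b);
  balg_norm_eq0 : forall a, A a -> N a = 0 -> a = 0;
  balg_normZ : forall (c : C) a, A a -> N (c *: a) = normc c * N a;
  balg_normD : forall a b, A a -> A b -> N (a + b) <= N a + N b;
  balg_normM : forall a b, A a -> A b -> N (a * b) <= N a * N b;
  balg_complete : forall a : nat -> T -> C, (forall n, A (a n)) ->
    (forall eps : R, 0 < eps -> exists n0, forall m n,
       (n0 <= m)%N -> (n0 <= n)%N -> N (a m - a n) < eps) ->
    exists2 b, A b & forall eps : R, 0 < eps -> exists n0, forall n,
       (n0 <= n)%N -> N (a n - b) < eps
}.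

(** Banach bimodules: [l a x] is a . x and [r x a] is x . a. *)
Record banach_bimodule (X : completeNormedModType C)
    (l : (T -> C) -> X -> X) (r : X -> (T -> C) -> X) : Prop :=
  BanachBimodule {
  bimod_l_linear : forall a, A a -> linear (l a);
  bimod_r_linear : forall a, A a -> linear (r^~ a);
  bimod_linear_l : forall (c : C) a b x, A a -> A b ->
    l (c *: a + b) x = c *: l a x + l b x;
  bimod_linear_r : forall (c : C) a b x, A a -> A b ->
    r x (c *: a + b) = c *: r x a + r x b;
  bimod_lM : forall a b x, A a -> A b -> l (a * b) x = l a (l b x);
  bimod_rM : forall a b x, A a -> A b -> r x (a * b) = r (r x a) b;
  bimod_lr : forall a b x, A a -> A b -> r (l a x) b = l a (r x b);
  bimod_bounded : exists M : R, forall a x, A a ->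
    `|l a x| <= (M * N a)%:C * `|x| /\ `|r x a| <= (M * N a)%:C * `|x|
}.

Definition bounded_functional (X : completeNormedModType C) (phi : X -> C) :=
  scalar phi /\ exists M : R, forall x, `|phi x| <= M%:C * `|x|.

(** Bounded derivations from A into the dual bimodule X^*, whose actions are
    (a . phi)(x) = phi (x . a) and (phi . a)(x) = phi (a . x). *)
Record dual_derivation (X : completeNormedModType C)
    (l : (T -> C) -> X -> X) (r : X -> (T -> C) -> X)
    (D : (T -> C) -> X -> C) : Prop := DualDerivation {
  dder_dual : forall a, A a -> bounded_functional (D a);
  dder_linear : forall (c : C) a b x, A a -> A b ->
    D (c *: a + b) x = c * D a x + D b x;
  dder_bounded : exists M : R, forall a x, A a ->
    `|D a x| <= (M * N a)%:C * `|x|;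
  dder_leibniz : forall a b x, A a -> A b ->
    D (a * b) x = D b (r x a) + D a (l b x)
}.

(** Johnson amenability: every bounded derivation into the dual of a Banach
    bimodule is inner, D a = a . phi - phi . a. *)
Definition amenable : Prop :=
  forall (X : completeNormedModType C)
    (l : (T -> C) -> X -> X) (r : X -> (T -> C) -> X),
  banach_bimodule l r ->
  forall D : (T -> C) -> X -> C, dual_derivation l r D ->
  exists2 phi : X -> C, bounded_functional phi &
    forall a x, A a -> D a x = phi (r x a) - phi (l a x).

End BanachAlgebra.

Definition regular_fourier (R : realType) (H : discreteHypergroup R)
    (lam : H -> R) : Prop :=
  banach_algebra (A_space lam) (Blam_norm lam).

(* Main.v *)
Require Import Defs.
From HB Require Import structures.
From mathcomp Require Import all_boot all_order all_algebra.
From mathcomp Require Import all_classical all_reals all_analysis.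
From mathcomp Require Import complex ring lra.

Set Implicit Arguments.
Unset Strict Implicit.
Unset Printing Implicit Defensive.

Import Order.TTheory GRing.Theory Num.Theory.
Import numFieldNormedType.Exports.
Import ComplexField.Normc.

Local Open Scope classical_set_scope.
Local Open Scope ring_scope.
Local Open Scope complex_scope.

(** For [x] in [H] let [T x] be the translation operator on finitely supported
    functions; the [T x] are commuting normal contractions of [l^2(lam)] and
    [ip (T x (T y~ delta_e)) delta_e] is [1 / lam x] if [x = y] and [0] otherwise.
    Given a bounded bilinear form [m] on the Fourier algebra and finitely
    supported [a, b], put [Q = \sum a(x) b(y) m(x,y) T x (T y~)].  Power iteration
    applied to [Q^* Q], started at [delta_e], and then to the operators [T x]
    produces a joint approximate eigenvector [u] whose [Q]-eigenvalue is at least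
    [|<Q delta_e, delta_e>|].  That eigenvalue is close to [m(a c, b c^* )], where
    [c(x) = <T x u, u>] has norm at most 1.  Hence the form
    [\sum a(x) b(x) m(x,x) / lam x] is bounded by the norm of [m].  Iterating, and
    interpolating over the finitely many values of [lam], the form
    [\sum a(x) b(x) m(x,x)] is bounded too.

    By (P2) there are finitely supported [e] of norm at most 1 tending to 1
    pointwise, so the elements [\sum e(x)^2 delta_x (x) delta_x] form a bounded
    approximate diagonal; it commutes exactly with the algebra. *)

(** * Complex moduli and pre-Hilbert spaces *)

(** The heuristic behind the power iteration is Plancherel. For characters c of H, the integral of
    c(x) conj(c(y)) against the Plancherel measure is 1 / lam x if x = y and 0 otherwise, so the
    weighted diagonal of m is an average of values m(a c, b conj c), and some c does at least as
    well as the average. Neither characters nor the completion of l^2(lam) are constructed: the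
    vector state at delta_e stands for the measure, and a joint approximate eigenvector for a
    character. Replacing its eigenvalues by the coefficients <T x u, u> keeps the multipliers inside
    the Fourier algebra, where their norm is controlled.

    The factor 1 / lam x is the obstacle: iteration only reaches polynomials in 1 / lam without
    constant term, and on a finite set of values one of these equals 1.

    The diagonal is never formed in a projective tensor product; it is paired with the forms (a, b)
    |-> D b (v . a). Limits along an ultrafilter replace weak-star compactness, and a correction
    term handles bimodules on which the approximate units do not tend to the identity. *)

Section ComplexFacts.
Variable R : realType.
Implicit Types z w : R[i].

Lemma normc_ge0 z : 0 <= normc z. Proof. by case: z => a b; exact: sqrtr_ge0. Qed.

Lemma normc_conj z : normc z^*%C = normc z.
Proof. by case: z => a b /=; rewrite sqrrN. Qed.

Lemma normcR (r : R) : normc r%:C = `|r|.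
Proof. by rewrite /= expr0n /= addr0 sqrtr_sqr. Qed.

Lemma normcB z w : normc (z - w) = normc (w - z).
Proof. by rewrite -normcN opprB. Qed.

Lemma mulcJ z : z * z^*%C = (normc z ^+ 2)%:C.
Proof.
case: z => a b /=; rewrite sqr_sqrtr ?addr_ge0 ?sqr_ge0 //.
by apply/eqP; rewrite eq_complex /=; apply/andP; split; apply/eqP; ring.
Qed.

Lemma conjcM z w : (z * w)^*%C = z^*%C * w^*%C.
Proof. exact: rmorphM. Qed.

Lemma conjc_sum (I : Type) (s : seq I) (F : I -> R[i]) :
  (\sum_(i <- s) F i)^*%C = \sum_(i <- s) (F i)^*%C.
Proof. exact: rmorph_sum. Qed.

Lemma normc_sum (I : Type) (s : seq I) (F : I -> R[i]) :
  normc (\sum_(i <- s) F i) <= \sum_(i <- s) normc (F i).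
Proof.
elim/big_rec2: _ => [|i y z _ IH]; first by rewrite normc0.
by apply: le_trans (le_normcD _ _) _; rewrite lerD2l.
Qed.

End ComplexFacts.

Section PreHilbert.
Variables (R : realType) (V : lmodType R[i]).
Local Notation C := R[i].

Record inner_product (ip : V -> V -> C) : Prop := InnerProduct {
  ip_linear : forall c u v w, ip (c *: u + v) w = c * ip u w + ip v w;
  ip_sym : forall u v, ip u v = (ip v u)^*%C;
  ip_ge0 : forall u, 0 <= complex.Re (ip u u);
  ip_eq0 : forall u, complex.Re (ip u u) = 0 -> u = 0
}.

Variable ip : V -> V -> C.
Hypothesis ipP : inner_product ip.

Definition N2 (u : V) : R := complex.Re (ip u u).
Definition nrm (u : V) : R := Num.sqrt (N2 u).

Lemma ipDl u v w : ip (u + v) w = ip u w + ip v w.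
Proof. by have := ip_linear ipP 1 u v w; rewrite scale1r mul1r. Qed.

Lemma ip0l w : ip 0 w = 0.
Proof. by apply: (addrI (ip 0 w)); rewrite -ipDl !addr0. Qed.

Lemma ipZl c u w : ip (c *: u) w = c * ip u w.
Proof. by have := ip_linear ipP c u 0 w; rewrite ip0l !addr0. Qed.

Lemma ipNl u w : ip (- u) w = - ip u w.
Proof. by rewrite -scaleN1r ipZl mulN1r. Qed.

Lemma ipDr u v w : ip w (u + v) = ip w u + ip w v.
Proof. by rewrite ip_sym // ipDl rmorphD /= -!(ip_sym ipP). Qed.

Lemma ipZr c u w : ip w (c *: u) = c^*%C * ip w u.
Proof. by rewrite ip_sym // ipZl rmorphM /= -(ip_sym ipP). Qed.

Lemma ip_suml (I : Type) (s : seq I) (F : I -> V) w :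
  ip (\sum_(i <- s) F i) w = \sum_(i <- s) ip (F i) w.
Proof. by elim/big_rec2: _ => [|i y z _ <-]; rewrite ?ip0l ?ipDl. Qed.

Lemma ip_sumr (I : Type) (s : seq I) (F : I -> V) w :
  ip w (\sum_(i <- s) F i) = \sum_(i <- s) ip w (F i).
Proof.
rewrite ip_sym // ip_suml rmorph_sum; apply: eq_bigr => i _ /=.
by rewrite -ip_sym.
Qed.

Lemma ipuu u : ip u u = (N2 u)%:C.
Proof.
rewrite /N2; have := ip_sym ipP u u; case: (ip u u) => a b /= [] hb.
by congr (_ +i* _); lra.
Qed.

Lemma N2_ge0 u : 0 <= N2 u. Proof. exact: ip_ge0. Qed.

Lemma N20 : N2 0 = 0. Proof. by rewrite /N2 ip0l. Qed.

Lemma N2_gt0 u : u != 0 -> 0 < N2 u.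
Proof.
by move=> u0; rewrite lt_def N2_ge0 andbT; apply: contra u0 => /eqP /(ip_eq0 ipP) ->.
Qed.

Lemma nrm_ge0 u : 0 <= nrm u. Proof. exact: sqrtr_ge0. Qed.

Lemma nrm0 : nrm 0 = 0. Proof. by rewrite /nrm N20 sqrtr0. Qed.

Lemma nrm_gt0 u : u != 0 -> 0 < nrm u.
Proof. by move=> u0; rewrite sqrtr_gt0 N2_gt0. Qed.

Lemma sqr_nrm u : nrm u ^+ 2 = N2 u. Proof. by rewrite sqr_sqrtr ?N2_ge0. Qed.

Lemma N2Z c u : N2 (c *: u) = normc c ^+ 2 * N2 u.
Proof.
rewrite /N2 ipZl ipZr mulrA mulcJ ipuu /=.
by rewrite mul0r subr0.
Qed.

Lemma nrmZ c u : nrm (c *: u) = normc c * nrm u.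
Proof. by rewrite /nrm N2Z sqrtrM ?sqr_ge0 // sqrtr_sqr ger0_norm ?normc_ge0. Qed.

Lemma nrmN u : nrm (- u) = nrm u.
Proof. by rewrite -scaleN1r nrmZ normcN normc1 mul1r. Qed.

Lemma N2D u v : N2 (u + v) = N2 u + N2 v + complex.Re (ip u v) *+ 2.
Proof.
rewrite {1}/N2 ipDl !ipDr (ip_sym ipP v u) !ipuu.
by case: (ip u v) => a b /=; ring.
Qed.

(** Cauchy-Schwarz for the real part: subtracting a real multiple of [v] suffices, and [normc_ip_le]
    recovers the modulus by rotating [u] by the conjugate of [ip u v]. *)
Lemma Re_ip_le u v : complex.Re (ip u v) <= nrm u * nrm v.
Proof.
have [->|v0] := eqVneq v 0; first by rewrite nrm0 mulr0 ip_sym // ip0l /=.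
have v_gt0 := N2_gt0 v0.
set r := complex.Re (ip u v).
have : 0 <= N2 ((N2 v)%:C *: u + (- r)%:C *: v) by exact: N2_ge0.
rewrite N2D !N2Z !normcR !real_normK ?num_real // ipZl ipZr conjc_real mulrA -rmorphM /=.
rewrite -/r => h.
have {}h : r ^+ 2 <= N2 u * N2 v.
  rewrite -subr_ge0 -(pmulr_rge0 _ v_gt0); move: h.
  by case: (ip u v) @r => a b /= h; apply: le_trans h _; rewrite le_eqVlt; apply/orP; left; apply/eqP; ring.
apply: le_trans (ler_norm _) _.
by rewrite -sqrtrM ?N2_ge0 // -sqrtr_sqr ler_wsqrtr.
Qed.

Lemma normc_ip_le u v : normc (ip u v) <= nrm u * nrm v.
Proof.
set z := ip u v; have [->|z0] := eqVneq (normc z) 0.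
  by rewrite mulr_ge0 ?nrm_ge0.
have zp : 0 < normc z by rewrite lt_def z0 normc_ge0.
have := Re_ip_le (z^*%C *: u) v.
rewrite ipZl nrmZ -/z mulrC mulcJ normc_conj /= expr2 -mulrA.
by rewrite ler_pM2l.
Qed.

Lemma ler_nrmD u v : nrm (u + v) <= nrm u + nrm v.
Proof.
rewrite -(@ler_pXn2r _ 2) ?nnegrE ?addr_ge0 ?nrm_ge0 // sqrrD !sqr_nrm N2D.
rewrite [leRHS]addrAC lerD2l lerMn2r /=.
exact: Re_ip_le.
Qed.

Lemma ler_nrmB u v : nrm (u - v) <= nrm u + nrm v.
Proof. by rewrite -[nrm v]nrmN ler_nrmD. Qed.

Lemma ler_nrm_sum (I : Type) (s : seq I) (F : I -> V) :
  nrm (\sum_(i <- s) F i) <= \sum_(i <- s) nrm (F i).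
Proof.
elim/big_rec2: _ => [|i y z _ IH]; first by rewrite nrm0.
by apply: le_trans (ler_nrmD _ _) _; rewrite lerD2l.
Qed.

End PreHilbert.

(** * Power iteration for normal operators *)

Section NormalOperators.
Variables (R : realType) (V : lmodType R[i]) (ip : V -> V -> R[i]).
Hypothesis ipP : inner_product ip.
Local Notation N2 := (N2 ip).
Local Notation nrm := (nrm ip).

(** The adjoint is part of the data, since an operator on a pre-Hilbert space need not have one. *)
Record normal_pair (B B' : V -> V) : Prop := NormalPair {
  normal_linear : linear B;
  normal_adj_linear : linear B';
  normal_adj : forall u v, ip (B u) v = ip u (B' v);
  normal_comm : forall u, B (B' u) = B' (B u)
}.

Lemma normal_adjC B B' u v : normal_pair B B' -> ip (B' u) v = ip u (B v).
Proof. by move=> nB; rewrite ip_sym // -(normal_adj nB) -ip_sym. Qed.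

Lemma N2_normal_adj B B' u : normal_pair B B' -> N2 (B' u) = N2 (B u).
Proof.
by move=> nB; rewrite /N2 (normal_adjC _ _ nB) (normal_comm nB)
  -(normal_adj nB).
Qed.

(** Log-convexity of k |-> N2 (B^k u): the left side is the square of <u, B' B u>, and normality
    gives B' (B u) and B (B u) the same norm. *)
Lemma N2_normal_le B B' u : normal_pair B B' ->
  N2 (B u) ^+ 2 <= N2 u * N2 (B (B u)).
Proof.
move=> nB; rewrite -(N2_normal_adj (B u) nB) -!sqr_nrm // -exprMn.
rewrite ler_pXn2r ?nnegrE ?sqr_ge0 ?mulr_ge0 ?nrm_ge0 //.
rewrite sqr_nrm // {1}/N2 (normal_adj nB); exact: Re_ip_le.
Qed.

(* The quotients [N2 (B^(k+1) xi) / N2 (B^k xi)] increase with [k] and stay below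
   [M ^ 2], so one of the first [K] increments is small; that increment is the
   squared relative error of [B^k xi] as an eigenvector of [B' B]. *)
Lemma power_iteration B B' (M eps : R) :
  normal_pair B B' -> (forall v, nrm (B v) <= M * nrm v) -> 0 < eps ->
  exists K : nat, forall xi, B xi != 0 -> exists (k : nat) (r : R),
    [/\ (k <= K)%N, iter k B xi != 0, N2 (B xi) <= r * N2 xi &
        nrm (B' (B (iter k B xi)) - r%:C *: iter k B xi)
          <= eps * nrm (iter k B xi)].
Proof.
move=> nB hM eps0.
have B0 : B 0 = 0.
  have := normal_linear nB 1 0 0; rewrite !scale1r addr0 => h.
  by apply: (addrI (B 0)); rewrite -h addr0.
(* Chosen so that M^2 d <= eps^2; the added 1 keeps the denominator positive. *)
pose d := eps ^+ 2 / (M ^+ 2 + 1).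
have M1 : 0 < M ^+ 2 + 1 by rewrite ltr_pwDr // sqr_ge0.
have d0 : 0 < d by rewrite divr_gt0 // exprn_gt0.
exists (Num.trunc (M ^+ 2 / d)) => xi Bxi; set K := Num.trunc _.
pose a k := N2 (iter k B xi); pose r k := a k.+1 / a k.
have xi0 : xi != 0 by apply: contra Bxi => /eqP ->; rewrite B0.
have aB k : a k.+1 ^+ 2 <= a k * a k.+2 by exact: N2_normal_le nB.
(* Log-convexity carries positivity forward only from two consecutive terms. *)
have a_gt0 k : 0 < a k /\ 0 < a k.+1.
  elim: k => [|k [ak ak1]]; first by split; exact: N2_gt0.
  split=> //; rewrite -(pmulr_rgt0 _ ak).
  by apply: lt_le_trans (aB k); rewrite exprn_gt0.
have {}a_gt0 k : 0 < a k by case: (a_gt0 k).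
have aM k : a k.+1 <= M ^+ 2 * a k.
  rewrite /a iterS -!sqr_nrm // -exprMn ler_pXn2r ?nnegrE ?nrm_ge0 //.
  by apply: le_trans (hM _); exact: nrm_ge0.
have rE k : a k.+1 = r k * a k by rewrite /r divfK // gt_eqF.
have r_ge0 k : 0 <= r k by rewrite divr_ge0 // ltW.
have rM k : r k <= M ^+ 2 by rewrite ler_pdivrMr.
have r_mono k : r k <= r k.+1.
  by rewrite ler_pdivrMr // mulrC /r mulrA ler_pdivlMr // -expr2 aB.
have r_ge k : r 0%N <= r k by elim: k => // k; move=> /le_trans; apply.
have [k kK hk] : exists2 k, (k <= K)%N & r k.+1 - r k <= d.
  apply: contrapT => h.
  have big k : (k <= K.+1)%N -> d * k%:R <= r k.
    elim: k => [|k IH] kK; first by rewrite mulr0.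
    have hk : d < r k.+1 - r k by rewrite ltNge; apply/negP => hd; apply: h; exists k.
    have := IH (ltnW kK); rewrite -natr1 mulrDr mulr1; lra.
  have := le_trans (big _ (leqnn _)) (rM _).
  rewrite mulrC -ler_pdivlMr // leNgt => /negP; apply.
  by have := Num.Theory.truncnS_gt (M ^+ 2 / d).
exists k, (r k); split=> //.
- by apply/eqP => h; have := a_gt0 k; rewrite /a h N20 // ltxx.
- by have := r_ge k; rewrite {1}/r ler_pdivrMr // a_gt0.
set eta := iter k B xi.
(* The squared error expands to r_k (r_(k+1) - r_k) a_k, where normality turns N2 (B' (B eta)) into
   N2 (B (B eta)). *)
rewrite -(@ler_pXn2r _ 2) ?nnegrE ?mulr_ge0 ?nrm_ge0 ?(ltW eps0) //.
rewrite exprMn !sqr_nrm // N2D // -scaleNr N2Z // (N2_normal_adj _ nB).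
rewrite -rmorphN normcR real_normK ?num_real // sqrrN ipZr // conjc_real.
rewrite (normal_adjC _ _ nB) ipuu //.
have -> : complex.Re ((- r k)%:C * (N2 (B eta))%:C) = - r k * N2 (B eta).
  by rewrite -rmorphM.
have -> : N2 (B (B eta)) = r k.+1 * (r k * a k) by rewrite -!rE.
have -> : N2 (B eta) = r k * a k by rewrite -rE.
have -> : N2 eta = a k by [].
have h : r k * (r k.+1 - r k) <= eps ^+ 2.
  apply: le_trans (ler_pM (r_ge0 k) _ (rM k) hk) _; first by rewrite subr_ge0.
  rewrite /d mulrCA -[leRHS]mulr1 ler_wpM2l ?sqr_ge0 //.
  by rewrite ler_pdivrMr // mul1r lerDl.
have := ler_wpM2r (ltW (a_gt0 k)) h; lra.
Qed.

End NormalOperators.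

(** * Joint approximate eigenvectors *)

Section JointApproximateSpectrum.
Variables (R : realType) (V : lmodType R[i]) (ip : V -> V -> R[i]).
Hypothesis ipP : inner_product ip.
Variables (J : eqType) (T : J -> V -> V) (star : J -> J).
Hypothesis T_normal : forall j, normal_pair ip (T j) (T (star j)).
Hypothesis T_comm : forall j k v, T j (T k v) = T k (T j v).
Hypothesis T_contr : forall j v, nrm ip (T j v) <= nrm ip v.
Local Notation C := R[i].
Local Notation N2 := (N2 ip).
Local Notation nrm := (nrm ip).

Definition commutes_with (A : V -> V) : Prop :=
  linear A /\ forall j v, A (T j v) = T j (A v).

Lemma linear_iter (A : V -> V) k : linear A -> linear (iter k A).
Proof. by move=> Al; elim: k => // k IH c u v; rewrite /= IH Al. Qed.

Lemma linear_comp2 (A B : V -> V) : linear A -> linear B -> linear (fun v => A (B v)).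
Proof. by move=> Al Bl c u v; rewrite Bl Al. Qed.

Lemma linear_scaleB (A : V -> V) (c : C) (u v : V) :
  linear A -> A (u - c *: v) = A u - c *: A v.
Proof. by move=> Al; rewrite addrC -scaleNr Al scaleNr addrC. Qed.

Lemma linear_0 (A : V -> V) : linear A -> A 0 = 0.
Proof. by move=> lA; have := linear_scaleB 1 0 0 lA; rewrite !scale1r !subrr. Qed.

Lemma linear_Z (A : V -> V) c v : linear A -> A (c *: v) = c *: A v.
Proof. by move=> lA; have := lA c v 0; rewrite (linear_0 lA) !addr0. Qed.

Lemma linear_sumE (A : V -> V) (I : Type) (s : seq I) (F : I -> V) :
  linear A -> A (\sum_(i <- s) F i) = \sum_(i <- s) A (F i).
Proof.
move=> lA; have AD u v : A (u + v) = A u + A v by have := lA 1 u v; rewrite !scale1r.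
by elim: s => [|i s IH]; rewrite ?big_nil ?linear_0 // !big_cons AD IH.
Qed.

Lemma linear_shift j (c : C) : linear (fun v => T j v + c *: v).
Proof.
move=> a u v; rewrite (normal_linear (T_normal j)) !scalerDr !scalerA.
by rewrite addrACA mulrC.
Qed.

(** Unlike the contraction [T j], its shift by a scalar of modulus 3 is bounded below. Iterating the
    shift cannot kill a vector, and k iterations enlarge the relative error of a commuting operator
    by at most 4^k. *)
Definition shift (p : J * C) (v : V) : V := T p.1 v + p.2 *: v.
Definition shift_adj (p : J * C) (v : V) : V := T (star p.1) v + p.2^*%C *: v.

Lemma shift_normal p : normal_pair ip (shift p) (shift_adj p).
Proof.
have nT := T_normal p.1; split.
- exact: linear_shift.
- move=> a u v; rewrite /shift_adj (normal_adj_linear nT) !scalerDr !scalerA.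
  by rewrite addrACA mulrC.
- move=> u v; rewrite /shift /shift_adj (ipDl ipP) (ipDr ipP) (normal_adj nT).
  by rewrite (ipZl ipP) (ipZr ipP) conjcK.
- move=> u; have lT := linear_shift p.1 p.2; have lT' := normal_adj_linear nT.
  rewrite /shift /shift_adj.
  have TD (A : V -> V) a w v : linear A -> A (w + a *: v) = A w + a *: A v.
    by move=> lA; rewrite addrC lA addrC.
  rewrite (TD _ _ _ _ (normal_linear nT)) (TD _ _ _ _ lT') T_comm.
  rewrite !scalerDr !scalerA -!addrA; congr (_ + _).
  by rewrite addrCA [p.2 * _]mulrC.
Qed.

Lemma shift_ub p v : normc p.2 = 3 -> nrm (shift p v) <= 4 * nrm v.
Proof.
move=> c3; apply: le_trans (ler_nrmD ipP _ _) _; rewrite nrmZ // c3.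
have := T_contr p.1 v; lra.
Qed.

Lemma shift_lb p v : normc p.2 = 3 -> nrm v <= nrm (shift p v).
Proof.
move=> c3; have -> : nrm v = (3 * nrm v - 2 * nrm v) by ring.
have : nrm (p.2 *: v) <= nrm (shift p v) + nrm (T p.1 v).
  have -> : p.2 *: v = shift p v - T p.1 v by rewrite /shift addrAC subrr add0r.
  exact: ler_nrmB.
rewrite nrmZ // c3; have := T_contr p.1 v; have := nrm_ge0 ip v; lra.
Qed.

Lemma iter_shift_ub p k v : normc p.2 = 3 -> nrm (iter k (shift p) v) <= 4 ^+ k * nrm v.
Proof.
move=> c3; elim: k => [|k IH] /=; first by rewrite mul1r.
apply: le_trans (shift_ub _ c3) _; rewrite exprS -mulrA.
by rewrite ler_wpM2l.
Qed.

Lemma iter_shift_lb p k v : normc p.2 = 3 -> nrm v <= nrm (iter k (shift p) v).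
Proof.
by move=> c3; elim: k => //= k IH; apply: le_trans IH (shift_lb _ c3).
Qed.

Lemma shift_comm A p v : commutes_with A -> A (shift p v) = shift p (A v).
Proof. by move=> [lA cA]; rewrite /shift addrC lA cA addrC. Qed.

Lemma shift_adj_comm A p v : commutes_with A -> A (shift_adj p v) = shift_adj p (A v).
Proof. by move=> [lA cA]; rewrite /shift_adj addrC lA cA addrC. Qed.

Lemma iter_shift_comm A p k v :
  commutes_with A -> A (iter k (shift p) v) = iter k (shift p) (A v).
Proof. by move=> cA; elim: k => //= k IH; rewrite shift_comm // IH. Qed.

Lemma commutes_T j : commutes_with (T j).
Proof. by split=> [|k v]; [exact: normal_linear (T_normal j)|exact: T_comm]. Qed.

Lemma commutes_shift2 p : commutes_with (fun v => shift_adj p (shift p v)).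
Proof.
split; first by apply: linear_comp2;
  [exact: normal_adj_linear (shift_normal p)|exact: normal_linear (shift_normal p)].
by move=> j v; rewrite (shift_adj_comm _ _ (commutes_T j)) (shift_comm _ _ (commutes_T j)).
Qed.

(** This lets the operators be treated one at a time: the passage to a vector adapted to the next
    operator must not undo the eigenvalue relations already obtained. *)
Definition approx_preserving (L : R) (xi eta : V) : Prop :=
  forall A, commutes_with A -> forall (c : C) (g : R),
    nrm (A xi - c *: xi) <= g * nrm xi -> nrm (A eta - c *: eta) <= L * g * nrm eta.

(* [L] does not depend on [xi], so the precision asked of the first operators of
   the list can be chosen in terms of the loss caused by the later ones. *)
Lemma joint_moduli (l : seq (J * C)) (eps : R) :
  (forall p, p \in l -> normc p.2 = 3) -> 0 < eps ->
  exists2 L : R, 0 < L & forall xi, xi != 0 -> exists eta,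
    [/\ eta != 0, approx_preserving L xi eta &
      forall p, p \in l -> exists r : R,
        nrm (shift_adj p (shift p eta) - r%:C *: eta) <= eps * nrm eta].
Proof.
move=> + eps0; elim: l => [|p l IH] hl.
  exists 1 => // xi xi0; exists xi; split=> // A _ c g; by rewrite mul1r.
have [|L0 L0_gt0 {}IH] := IH; first by move=> q ql; apply: hl; rewrite inE ql orbT.
have c3 : normc p.2 = 3 by apply: hl; rewrite inE eqxx.
have [|K hK] := power_iteration ipP (shift_normal p) (fun v => shift_ub v c3)
  (_ : 0 < eps / L0); first by rewrite divr_gt0.
exists (L0 * 4 ^+ K) => [|xi xi0]; first by rewrite mulr_gt0 // exprn_gt0.
have [|k [r [kK eta0 _ hr]]] := hK xi.
  apply: contra xi0 => /eqP h; have := shift_lb xi c3.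
  rewrite h nrm0 // => h0; apply: contraLR h0 => h0.
  by rewrite -ltNge nrm_gt0.
have [eta [eta'0 etaA etal]] := IH _ eta0.
exists eta; split=> // [A cA c g hg|q].
  have -> : L0 * 4 ^+ K * g = L0 * (4 ^+ K * g) by rewrite mulrA.
  apply: etaA => //.
  (* [A] commutes with the iterated shift, so its error at the iterate is the iterate of its error:
     at most 4^k times larger, while the iterate itself is no shorter than [xi]. *)
  have lp := linear_iter k (normal_linear (shift_normal p)).
  rewrite iter_shift_comm // -(linear_scaleB _ _ _ lp).
  apply: le_trans (iter_shift_ub k _ c3) _.
  have g0 : 0 <= g.
    by have := le_trans (nrm_ge0 ip _) hg; rewrite pmulr_lge0 // nrm_gt0.
  rewrite -mulrA; apply: ler_pM; rewrite ?nrm_ge0 ?exprn_ge0 //.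
    by rewrite ler_weXn2l // ler1n.
  apply: le_trans hg _; rewrite ler_wpM2l //; exact: iter_shift_lb.
rewrite inE => /orP[/eqP ->|]; last exact: etal.
exists r; have := etaA _ (commutes_shift2 p) _ _ hr.
by rewrite mulrCA divff ?mulr1 // gt_eqF.
Qed.

(* Polarization: [36 T = \sum_c c (T + c)^* (T + c)] over the four [c = 3 i^k]. *)
Lemma joint_eigenvector (s : seq J) (eps : R) : 0 < eps ->
  exists2 L : R, 0 < L & forall xi, xi != 0 -> exists eta,
    [/\ eta != 0, approx_preserving L xi eta &
      forall j, j \in s -> exists t : C,
        nrm (T j eta - t *: eta) <= eps * nrm eta].
Proof.
move=> eps0; pose c4 : seq C := [:: 3%:C; 3 *i; (- 3)%:C; (- 3) *i].
have hl p : p \in [seq (j, c) | j <- s, c <- c4] -> normc p.2 = 3.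
  move=> /allpairsP [[j c] /= [_ + ->]] /=.
  rewrite !inE => /or4P[] /eqP -> /=;
    rewrite ?expr0n /= ?addr0 ?add0r sqrtr_sqr ?normrN ger0_norm //.
have [L L0 hL] := joint_moduli hl eps0; exists L => // xi xi0.
have [eta [eta0 etaA etal]] := hL _ xi0; exists eta; split=> // j js.
have h c : c \in c4 -> exists r : R,
    nrm (shift_adj (j, c) (shift (j, c) eta) - r%:C *: eta) <= eps * nrm eta.
  by move=> cc; apply: etal; apply/allpairsP; exists (j, c).
have [|r1 h1] := h 3%:C; first by rewrite !inE eqxx.
have [|r2 h2] := h (3 *i); first by rewrite !inE eqxx ?orbT.
have [|r3 h3] := h (- 3)%:C; first by rewrite !inE eqxx ?orbT.
have [|r4 h4] := h ((- 3) *i); first by rewrite !inE eqxx ?orbT.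
pose D (c : C) (r : R) := shift_adj (j, c) (shift (j, c) eta) - r%:C *: eta.
pose t36 : C := 3%:C * r1%:C + 3 *i * r2%:C + (-3)%:C * r3%:C + (-3) *i * r4%:C.
have E : 36%:C *: T j eta - t36 *: eta = 3%:C *: D 3%:C r1 + 3 *i *: D (3 *i) r2
    + (-3)%:C *: D (-3)%:C r3 + (-3) *i *: D ((-3) *i) r4.
  have lT' := normal_adj_linear (T_normal j).
  have TD a w v : T (star j) (w + a *: v) = T (star j) w + a *: T (star j) v.
    by rewrite addrC lT' addrC.
  (* Everything is expanded in the four vectors T* T eta, T* eta, T eta and eta, which reduces the
     identity to four scalar ones. *)
  rewrite /t36; set z := T j eta; set y := T (star j) eta; set x := T (star j) z.
  pose F (a b c d : C) := a *: x + b *: y + (c *: z + d *: eta).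
  have FD a b c d a' b' c' d' : F a b c d + F a' b' c' d' = F (a + a') (b + b') (c + c') (d + d').
    by rewrite /F !scalerDl addrACA; congr (_ + _); rewrite addrACA.
  have FZ k a b c d : k *: F a b c d = F (k * a) (k * b) (k * c) (k * d).
    by rewrite /F !scalerDr !scalerA.
  have DF c r : D c r = F 1 c c^*%C (c * c^*%C - r%:C).
    change (T (star j) (z + c *: eta) + c^*%C *: (z + c *: eta) - r%:C *: eta =
      F 1 c c^*%C (c * c^*%C - r%:C)).
    by rewrite TD /F scale1r scalerDr scalerA [c^*%C * c]mulrC scalerBl !addrA.
  rewrite !DF !FZ !FD.
  have -> : 36%:C *: z - t36 *: eta = F 0 0 36%:C (- t36).
    by rewrite /F !scale0r !add0r scaleNr.
  by congr F; apply/eqP; rewrite eq_complex /=; apply/andP; split; apply/eqP; ring.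
exists ((36%:C)^-1 * t36).
have n36 : normc (36%:C : C) = 36 by rewrite normcR ger0_norm.
rewrite -(ler_pM2l (_ : 0 < 36)) // -{1}n36 -nrmZ // scalerBr scalerA mulrA.
rewrite divff ?mul1r; last by rewrite eq_complex /= negb_and pnatr_eq0.
rewrite E.
have b (c : C) r : normc c = 3 -> nrm (D c r) <= eps * nrm eta ->
    nrm (c *: D c r) <= 3 * (eps * nrm eta).
  by move=> c3 hD; rewrite nrmZ // c3 ler_wpM2l.
have n1 : normc (3%:C : C) = 3 by rewrite normcR ger0_norm.
have n2 : normc (3 *i : C) = 3 by rewrite /= expr0n add0r sqrtr_sqr ger0_norm.
have n3 : normc ((- 3)%:C : C) = 3 by rewrite normcR normrN ger0_norm.
have n4 : normc ((- 3) *i : C) = 3.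
  by rewrite /= expr0n add0r sqrtr_sqr normrN ger0_norm.
(* The four terms add up to at most 12 eps, below the 36 eps allowed. *)
apply: le_trans (ler_nrmD ipP _ _) _.
have := b _ _ n4 h4; have := b _ _ n3 h3; have := b _ _ n2 h2; have := b _ _ n1 h1.
have := ler_nrmD ipP (3%:C *: D 3%:C r1) (3 *i *: D (3 *i) r2).
have := ler_nrmD ipP (3%:C *: D 3%:C r1 + 3 *i *: D (3 *i) r2) ((-3)%:C *: D (-3)%:C r3).
have : 0 <= eps * nrm eta by rewrite mulr_ge0 ?nrm_ge0 // ltW.
rewrite /D; lra.
Qed.

(** [Q] comes first because its lower bound is relative to the starting vector [xi]. Since [L] does
    not depend on the vector, precision eps / L for [Q' Q] leaves an error eps after the operators
    [T j] have been treated. *)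
Lemma joint_eigenvector_above (Q Q' : V -> V) (M : R) (s : seq J) (eps : R) (xi : V) :
  normal_pair ip Q Q' -> (forall v, nrm (Q v) <= M * nrm v) ->
  commutes_with Q -> commutes_with Q' -> 0 < eps -> Q xi != 0 ->
  exists eta, [/\ eta != 0,
    forall j, j \in s -> exists t : C, nrm (T j eta - t *: eta) <= eps * nrm eta
    & N2 (Q xi) * N2 eta <= (N2 (Q eta) + eps * N2 eta) * N2 xi].
Proof.
move=> nQ QM [lQ cQ] [lQ' cQ'] eps0 Qxi.
have xi0 : xi != 0.
  apply: contra Qxi => /eqP ->.
  by have := linear_scaleB 1 0 0 lQ; rewrite !scale1r !subrr => ->.
have [L L0 hL] := joint_eigenvector s eps0.
have [|K hK] := power_iteration ipP nQ QM (_ : 0 < eps / L); first by rewrite divr_gt0.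
have [k [q [_ eta0 hq Qq]]] := hK xi Qxi.
have [eta [eta'0 etaA etas]] := hL _ eta0.
exists eta; split=> //.
have cQQ : commutes_with (fun v => Q' (Q v)).
  by split; [exact: linear_comp2|move=> j v; rewrite cQ cQ'].
have := etaA _ cQQ _ _ Qq; rewrite mulrCA divff ?mulr1 ?gt_eqF //.
move=> hQ; have N2Q : N2 (Q eta) = q * N2 eta + complex.Re (ip (Q' (Q eta) - q%:C *: eta) eta).
  rewrite (ipDl ipP) (ipNl ipP) (ipZl ipP) (normal_adjC ipP _ _ nQ) !ipuu // -rmorphM -rmorphB /=.
  by ring.
have hR : - complex.Re (ip (Q' (Q eta) - q%:C *: eta) eta) <= eps * N2 eta.
  have -> : - complex.Re (ip (Q' (Q eta) - q%:C *: eta) eta) =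
    complex.Re (ip (- (Q' (Q eta) - q%:C *: eta)) eta) by rewrite (ipNl ipP); case: (ip _ _).
  apply: le_trans (Re_ip_le ipP _ _) _; rewrite nrmN // -sqr_nrm // expr2 mulrA.
  by rewrite ler_wpM2r ?nrm_ge0.
have h1 := ler_wpM2r (N2_ge0 ipP eta) hq.
apply: le_trans h1 _.
rewrite [leRHS]mulrC [q * _]mulrC -mulrA ler_wpM2l ?N2_ge0 //.
by rewrite N2Q; lra.
Qed.

End JointApproximateSpectrum.

(** * Finite sums and finitely supported functions *)

Section FiniteSums.
Variable T : choiceType.

Lemma finite_set_seq (A : set T) :
  finite_set A -> exists2 s : seq T, uniq s & forall x, A x -> x \in s.
Proof.
move=> /finite_seqP[s ->]; exists (undup s); first exact: undup_uniq.
by move=> x; rewrite mem_undup.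
Qed.

Lemma fsum_seq (V : nmodType) (f : T -> V) (s : seq T) :
  uniq s -> (forall x, f x != 0 -> x \in s) ->
  \sum_(x \in [set: T]) f x = \sum_(x <- s) f x.
Proof.
move=> us hs; rewrite (fsbig_seq _ f us); apply/esym/fsbig_widen => // x [_] /= xs.
by apply: contra_notP xs => /eqP; exact: hs.
Qed.

Lemma sum_uniq_eq (V : nmodType) (f : T -> V) (s s' : seq T) :
  uniq s -> uniq s' -> (forall x, f x != 0 -> x \in s) ->
  (forall x, f x != 0 -> x \in s') -> \sum_(x <- s) f x = \sum_(x <- s') f x.
Proof. by move=> us us' h h'; rewrite -!fsum_seq. Qed.

Variable R : realType.
Implicit Types f : T -> R.

Lemma ler_sum_uniq f (s s' : seq T) : (forall x, 0 <= f x) ->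
  uniq s -> uniq s' -> {subset s <= s'} ->
  \sum_(x <- s) f x <= \sum_(x <- s') f x.
Proof.
move=> f0 us us' ss.
have ->: \sum_(x <- s) f x = \sum_(x <- s' | x \in s) f x.
  rewrite -[RHS]big_filter; apply: perm_big; apply: uniq_perm => //.
    by rewrite filter_uniq.
  by move=> x; rewrite mem_filter andb_idr // => /ss.
by rewrite [leLHS]big_mkcond; apply: ler_sum => x _; case: ifP.
Qed.

Lemma esum_seq f (s : seq T) : (forall x, 0 <= f x) ->
  uniq s -> (forall x, f x != 0 -> x \in s) ->
  \esum_(x in [set: T]) (f x)%:E = (\sum_(x <- s) f x)%:E.
Proof.
move=> f0 us hs; rewrite (_ : esum _ _ = \esum_(x in [set` s]) (f x)%:E).
  rewrite esum_fset //; last by move=> x _; rewrite lee_fin.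
  by rewrite -fsbig_seq // sumEFin.
rewrite [RHS]esum_mkcond; apply: eq_esum => x _; case: ifPn => // xs.
congr (_%:E); apply/eqP; apply: contraNT xs => /hs; by rewrite inE.
Qed.

Lemma esum_ge_seq f (s : seq T) : (forall x, 0 <= f x) -> uniq s ->
  ((\sum_(x <- s) f x)%:E <= \esum_(x in [set: T]) (f x)%:E)%E.
Proof.
move=> f0 us; apply: esum_ge; exists [set` s]; first by split.
by rewrite -fsbig_seq // sumEFin.
Qed.

Lemma esum_le_seq f (M : R) :
  (forall s, uniq s -> \sum_(x <- s) f x <= M) ->
  (\esum_(x in [set: T]) (f x)%:E <= M%:E)%E.
Proof.
move=> h; apply: ge_ereal_sup => _ [A [/finite_seqP[s As] _] <-].
have -> : A = [set` undup s] by rewrite As; apply/seteqP; split=> x /=; rewrite mem_undup.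
by rewrite -fsbig_seq ?undup_uniq // sumEFin lee_fin h ?undup_uniq.
Qed.

Lemma esum_gt_seq f (M : R) :
  (M%:E < \esum_(x in [set: T]) (f x)%:E)%E ->
  exists2 s, uniq s & M < \sum_(x <- s) f x.
Proof.
move=> h; apply: contrapT => hn.
have : (\esum_(x in [set: T]) (f x)%:E <= M%:E)%E.
  apply: esum_le_seq => s us; rewrite leNgt; apply/negP => hM.
  by apply: hn; exists s.
by rewrite leNgt h.
Qed.

Lemma csum_seq (f : T -> R[i]) (s : seq T) :
  uniq s -> (forall x, f x != 0 -> x \in s) -> csum f = \sum_(x <- s) f x.
Proof.
move=> us hs.
have rs (g : T -> R) : (forall x, g x != 0 -> x \in s) ->
    fine (\esum_(x in [set: T]) (EFin \o g)^\+%E x)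
    - fine (\esum_(x in [set: T]) (EFin \o g)^\-%E x) = \sum_(x <- s) g x.
  move=> hg.
  have -> : (EFin \o g)^\+%E = (fun x => (Num.max (g x) 0)%:E).
    by apply/funext => x; rewrite funeposE EFin_max.
  have -> : (EFin \o g)^\-%E = (fun x => (Num.max (- g x) 0)%:E).
    by apply/funext => x; rewrite funenegE EFin_max.
  rewrite (@esum_seq (fun x => Num.max (g x) 0) s) //; last 2 first.
  - by move=> x; rewrite le_max lexx orbT.
  - by move=> x h; apply: hg; apply: contra h => /eqP ->; rewrite maxxx.
  rewrite (@esum_seq (fun x => Num.max (- g x) 0) s) //; last 2 first.
  - by move=> x; rewrite le_max lexx orbT.
  - by move=> x h; apply: hg; apply: contra h => /eqP ->; rewrite oppr0 maxxx.
  rewrite /= -sumrB; apply: eq_bigr => x _.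
  by case: (lerP 0 (g x)) => h; case: (lerP 0 (- g x)) => h'; lra.
rewrite /csum !rs => [|x h|x h].
- by elim: s {us hs rs} => [|x s IH]; rewrite ?big_nil // !big_cons -IH; case: (f x).
- by apply: hs; apply: contra h => /eqP ->.
- by apply: hs; apply: contra h => /eqP ->.
Qed.

End FiniteSums.

Section FiniteSupport.
Variables (T : choiceType) (R : realType).
Local Notation C := R[i].

Definition fsupp : {pred T -> C} := fun f => `[< finite_set [set x | f x != 0] >].

Lemma fsupp_submod : GRing.submod_closed fsupp.
Proof.
split=> [|c f g].
  apply/asboolP; rewrite (_ : [set _ | _] = set0); first exact: finite_set0.
  by apply/seteqP; split=> x //=; rewrite eqxx.
move=> /asboolP hf /asboolP hg; apply/asboolP.
apply: (@sub_finite_set _ _ ([set x | f x != 0] `|` [set x | g x != 0])).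
  move=> x /=; case: (eqVneq (f x) 0) => [f0|]; last by left.
  case: (eqVneq (g x) 0) => [g0|]; last by right.
  have -> : (c *: f + g) x = c * f x + g x by [].
  by rewrite f0 g0 mulr0 addr0 eqxx.
by rewrite finite_setU.
Qed.

HB.instance Definition _ :=
  GRing.isSubmodClosed.Build C (T -> C) fsupp fsupp_submod.

(** As a submodule, the finitely supported functions inherit the module structure over which the
    pre-Hilbert results are stated. *)
Record fsf := FSF { fsf_val :> T -> C; fsf_valP : fsf_val \in fsupp }.

HB.instance Definition _ := [isSub for fsf_val].
HB.instance Definition _ := [Choice of fsf by <:].
HB.instance Definition _ := [SubChoice_isSubLmodule of fsf by <:].

Lemma fsf_eq (f g : fsf) : (forall x, f x = g x) -> f = g.
Proof. by move=> h; apply: val_inj; apply/funext. Qed.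

Lemma fsfD (f g : fsf) x : (f + g) x = f x + g x. Proof. by []. Qed.
Lemma fsfZ (c : C) (f : fsf) x : (c *: f) x = c * f x. Proof. by []. Qed.

End FiniteSupport.

(** * Translations on a discrete hypergroup *)

Section HypergroupFacts.
Variables (R : realType) (H : discreteHypergroup R) (lam : H -> R).
Hypothesis Hcomm : hcommutative H.
Hypothesis Hhaar : left_haar lam.
Hypothesis Hnorm : lam (hunit H) = 1.
Local Notation C := R[i].
Local Notation e := (hunit H).
Local Notation V := (fsf H R).

Lemma fsf_support (f : V) : exists2 s : seq H, uniq s & forall x, f x != 0 -> x \in s.
Proof.
have /asboolP/finite_set_seq[s us hs] := fsf_valP f; exists s => // x; exact: hs.
Qed.

Lemma fsf_support2 (f g : V) : exists2 s : seq H, uniq s &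
  (forall x, f x != 0 -> x \in s) /\ (forall x, g x != 0 -> x \in s).
Proof.
have [s us hs] := fsf_support f; have [t ut ht] := fsf_support g.
exists (undup (s ++ t)); first exact: undup_uniq.
by split=> x h; rewrite mem_undup mem_cat; [rewrite hs|rewrite ht ?orbT].
Qed.

Lemma fsf0_out (f : V) (s : seq H) x :
  (forall x, f x != 0 -> x \in s) -> x \notin s -> f x = 0.
Proof. by move=> hs; apply: contraNeq => /hs. Qed.

Lemma hconv_seq (x y : H) : exists2 s : seq H, uniq s &
  (forall z, hconv x y z != 0 -> z \in s) /\ \sum_(z <- s) hconv x y z = 1.
Proof.
have [s us hs] := finite_set_seq (hconv_fin x y).
by exists s => //; split=> //; rewrite -(hconv_sum1 x y) (fsum_seq us).
Qed.

Lemma hconv_sum_le1 (x y : H) (s : seq H) : uniq s -> \sum_(z <- s) hconv x y z <= 1.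
Proof.
move=> us; have [t ut [ht <-]] := hconv_seq x y.
have -> : \sum_(z <- t) hconv x y z = \sum_(z <- undup (s ++ t)) hconv x y z.
  apply: sum_uniq_eq => //; first exact: undup_uniq.
  by move=> z /ht zt; rewrite mem_undup mem_cat zt orbT.
apply: ler_sum_uniq => //; first by move=> z; exact: hconv_ge0.
  exact: undup_uniq.
by move=> z zs; rewrite mem_undup mem_cat zs.
Qed.

Lemma hconv_e0 (x y : H) : x != hinv y -> hconv x y e = 0.
Proof. by apply: contraNeq => /hconv_unitP ->. Qed.

Lemma hconv_e_neq0 (x : H) : hconv (hinv x) x e != 0.
Proof. exact/hconv_unitP. Qed.

Lemma lam_ge0 x : 0 <= lam x. Proof. by case: Hhaar. Qed.

(** Invariance under [hinv x], evaluated at the unit, where only [y = x] contributes. *)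
Lemma lam_mass x : lam x * hconv (hinv x) x e = 1.
Proof.
case: Hhaar => _ _ /(_ (hinv x) e).
rewrite Hnorm (@esum_seq _ _ (fun y => lam y * hconv (hinv x) y e) [:: x]) //.
- by rewrite big_seq1 => -[].
- by move=> y; rewrite mulr_ge0 ?lam_ge0 // hconv_ge0.
move=> y; rewrite mulf_eq0 negb_or inE => /andP[_ /hconv_unitP].
by move=> /(can_inj (@hinvK _ H)) ->.
Qed.

Lemma lam_gt0 x : 0 < lam x.
Proof.
rewrite lt_def lam_ge0 andbT; apply/eqP => h; have := lam_mass x.
by rewrite h mul0r => /eqP; rewrite eq_sym oner_eq0.
Qed.

Lemma lam_inv x : lam (hinv x) = lam x.
Proof.
have h0 := hconv_e_neq0 x.
apply: (mulIf h0); rewrite lam_mass -(lam_mass (hinv x)) hinvK.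
by rewrite Hcomm.
Qed.

Lemma hconv_eE x : hconv (hinv x) x e = (lam x)^-1.
Proof.
by rewrite -[RHS]mul1r -(lam_mass x) mulrAC divff ?mul1r // lt0r_neq0 // lam_gt0.
Qed.

(* Associativity of [y . x . z~], evaluated at [e]. *)
Lemma hconv_lam_adj x y z : lam y * hconv x y z = lam z * hconv (hinv x) z y.
Proof.
have := hconvA y x (hinv z) e.
rewrite (@fsum_seq _ _ _ [:: z]) //; last first.
  move=> u; rewrite mulf_eq0 negb_or inE => /andP[_ /hconv_unitP].
  by rewrite hinvK => ->.
rewrite (@fsum_seq _ _ _ [:: hinv y]) //; last first.
  move=> u; rewrite mulf_eq0 negb_or inE => /andP[_ /hconv_unitP ->].
  by rewrite hinvK.
rewrite !big_seq1 hconvV hinvK.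
have -> : hconv z (hinv z) e = (lam z)^-1 by rewrite Hcomm hconv_eE.
have -> : hconv y (hinv y) e = (lam y)^-1 by rewrite Hcomm hconv_eE.
have ly := lt0r_neq0 (lam_gt0 y); have lz := lt0r_neq0 (lam_gt0 z).
rewrite Hcomm [hconv z _ y]Hcomm => h.
have -> : lam y * hconv x y z = lam y * lam z * (hconv x y z / lam z) by field.
by rewrite h; field.
Qed.

Lemma hprod_evalE (f : H -> C) x y (s : seq H) : uniq s ->
  (forall z, hconv x y z != 0 -> f z != 0 -> z \in s) ->
  hprod_eval f x y = \sum_(z <- s) (hconv x y z)%:C * f z.
Proof.
move=> us hs; apply: fsum_seq => // z; rewrite mulf_eq0 negb_or => /andP[h fz].
by apply: hs => //; apply: contra h => /eqP ->.
Qed.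

(** By [hconv_lam_adj], the points y for which x.y charges z are those charged by x~.z, and there
    are finitely many of them. *)
Lemma hprod_eval_fsupp (f : V) x : hprod_eval f x \in @fsupp H R.
Proof.
have [s us hs] := fsf_support f; apply/asboolP.
apply: (@sub_finite_set _ _ (\bigcup_(z in [set` s]) [set y | hconv (hinv x) z y != 0])).
  move=> y /=; rewrite (hprod_evalE us) => [h|z _]; last exact: hs.
  have [z zs hz] : exists2 z, z \in s & hconv x y z != 0.
    apply: contrapT => hn; case/eqP: h; rewrite big1_seq // => z /andP[_ zs].
    have -> : hconv x y z = 0 by apply/eqP; apply/negPn/negP => hz; apply: hn; exists z.
    by rewrite mul0r.
  exists z => //=; apply: contra hz => /eqP h0; have := hconv_lam_adj x y z.
  by rewrite h0 mulr0 => /eqP; rewrite mulf_eq0 (gt_eqF (lam_gt0 y)).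
by apply: bigcup_finite => // z _; exact: hconv_fin.
Qed.

(** The convention is f(x.y), without inverse: [T x] is [ltrans (hinv x)], the adjoint of the left
    translation by x. *)
Definition translation (x : H) (f : V) : V := FSF (hprod_eval_fsupp f x).

Local Notation T := translation.

Lemma TE x (f : V) y : T x f y = hprod_eval f x y. Proof. by []. Qed.

Lemma hprod_eval_linear (c : C) (f g : H -> C) x y :
  hprod_eval (c *: f + g) x y = c * hprod_eval f x y + hprod_eval g x y.
Proof.
have [s us [hs _]] := hconv_seq x y.
rewrite !(hprod_evalE us); [|by move=> z /hs..].
rewrite mulr_sumr -big_split; apply: eq_bigr => z _ /=.
have -> : (c *: f + g) z = c * f z + g z by [].
by rewrite mulrDr mulrCA.
Qed.

Lemma T_linear x : linear (T x).
Proof. by move=> c f g; apply: fsf_eq => y; rewrite TE hprod_eval_linear. Qed.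

(** By commutativity both sides integrate f against the product of x, y and t, bracketed
    differently; [E] writes each as a sum over one finite set before associativity is applied. *)
Lemma hprod_evalC (f : H -> C) x y t :
  hprod_eval (hprod_eval f y) x t = hprod_eval (hprod_eval f x) y t.
Proof.
have [s us [hs _]] := hconv_seq x t; have [s' us' [hs' _]] := hconv_seq y t.
have /finite_set_seq[r ur hr] : finite_set (\bigcup_(z in [set` s ++ s'])
    ([set w | hconv y z w != 0] `|` [set w | hconv x z w != 0])).
  apply: bigcup_finite => // z _; rewrite finite_setU; split; exact: hconv_fin.
have E a b (q : seq H) : uniq q -> (forall z, hconv a t z != 0 -> z \in q) ->
    (forall z w, z \in q -> hconv b z w != 0 -> w \in r) ->
    hprod_eval (hprod_eval f b) a t =
    \sum_(w <- r) (\sum_(z \in [set: H]) hconv a t z * hconv z b w)%:C * f w.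
  move=> uq hq hqr; rewrite (hprod_evalE uq) => [|z /hq //].
  have -> : \sum_(z <- q) (hconv a t z)%:C * hprod_eval f b z =
      \sum_(z <- q) \sum_(w <- r) (hconv a t z * hconv z b w)%:C * f w.
    apply: eq_big_seq => z zq; rewrite (hprod_evalE ur) => [|w h _]; last exact: hqr h.
    rewrite mulr_sumr; apply: eq_bigr => w _; rewrite mulrA -rmorphM /=.
    by rewrite [hconv b z w]Hcomm.
  rewrite exchange_big; apply: eq_bigr => w _ /=; rewrite -mulr_suml; congr (_ * _).
  rewrite (fsum_seq uq) ?rmorph_sum // => z; rewrite mulf_eq0 negb_or => /andP[h _].
  exact: hq.
rewrite (E x y s) //; last first.
  by move=> z w zs h; apply: hr; exists z; rewrite /= ?mem_cat ?zs //; left.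
rewrite (E y x s') //; last first.
  by move=> z w zs h; apply: hr; exists z; rewrite /= ?mem_cat ?zs ?orbT //; right.
apply: eq_bigr => w _; congr (_%:C * _).
by rewrite hconvA; apply: eq_fsbigr => z _; rewrite [hconv t y z]Hcomm [hconv x z w]Hcomm.
Qed.

Lemma T_comm x y f : T x (T y f) = T y (T x f).
Proof. by apply: fsf_eq => t; exact: hprod_evalC. Qed.

Definition ip (f g : V) : C := \sum_(y \in [set: H]) (lam y)%:C * f y * (g y)^*%C.

Lemma ip_seql (f g : V) s : uniq s -> (forall x, f x != 0 -> x \in s) ->
  ip f g = \sum_(y <- s) (lam y)%:C * f y * (g y)^*%C.
Proof.
move=> us hs; apply: fsum_seq => // y.
by rewrite !mulf_eq0 !negb_or => /andP[/andP[_ /hs]].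
Qed.

Lemma ip_seqr (f g : V) s : uniq s -> (forall x, g x != 0 -> x \in s) ->
  ip f g = \sum_(y <- s) (lam y)%:C * f y * (g y)^*%C.
Proof.
move=> us hs; apply: fsum_seq => // y.
by rewrite !mulf_eq0 !negb_or conjc_eq0 => /andP[/andP[_ _] /hs].
Qed.

Lemma N2E (f : V) s : uniq s -> (forall x, f x != 0 -> x \in s) ->
  N2 ip f = \sum_(y <- s) lam y * normc (f y) ^+ 2.
Proof.
move=> us hs; rewrite /N2 (ip_seql _ us hs).
under eq_bigr do rewrite -mulrA mulcJ -rmorphM.
by rewrite -rmorph_sum.
Qed.

Lemma ipP : inner_product ip.
Proof.
split=> [c u v w|u v|u|u].
- have [s us hs] := fsf_support w.
  rewrite !(ip_seqr _ us hs) mulr_sumr -big_split; apply: eq_bigr => y _.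
  have -> : (c *: u + v) y = c * u y + v y by [].
  rewrite /=; ring.
- have [s us [hs hs']] := fsf_support2 u v.
  rewrite (ip_seql _ us hs) (ip_seql _ us hs') conjc_sum.
  by apply: eq_bigr => y _; rewrite !conjcM conjc_real conjcK mulrAC.
- have [s us hs] := fsf_support u; have := N2E us hs; rewrite /N2 => ->.
  by rewrite sumr_ge0 // => y _; rewrite mulr_ge0 ?lam_ge0 ?sqr_ge0.
- have [s us hs] := fsf_support u; have := N2E us hs; rewrite /N2 => -> /eqP.
  rewrite psumr_eq0 => [/allP h|y _]; last by rewrite mulr_ge0 ?lam_ge0 ?sqr_ge0.
  apply: fsf_eq => y; case: (boolP (y \in s)) => [ys|]; last exact: fsf0_out.
  have := h y ys; rewrite /= mulf_eq0 (gt_eqF (lam_gt0 y)) /= sqrf_eq0 => /eqP.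
  exact: eq0_normc.
Qed.

Lemma T_adj x f g : ip (T x f) g = ip f (T (hinv x) g).
Proof.
have [s us hs] := fsf_support f; have [t ut ht] := fsf_support g.
rewrite (ip_seqr _ ut ht) (ip_seql _ us hs).
under eq_bigr => y _ do rewrite TE (hprod_evalE us (fun z _ => @hs z)) mulr_sumr mulr_suml.
under [RHS]eq_bigr => z _ do rewrite TE (hprod_evalE ut (fun y _ => @ht y)) conjc_sum mulr_sumr.
rewrite exchange_big; apply: eq_bigr => z _; apply: eq_bigr => y _ /=.
rewrite conjcM conjc_real !mulrA -rmorphM hconv_lam_adj rmorphM.
by rewrite -!mulrA; congr (_ * _); rewrite mulrCA.
Qed.

Lemma T_normal x : normal_pair ip (T x) (T (hinv x)).
Proof.
by split=> [||u v|u]; [exact: T_linear|exact: T_linear|exact: T_adj|exact: T_comm].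
Qed.

(** Jensen's inequality for the square. The masses over [s] may sum to less than 1, so it is read
    off from the nonnegative second moment about [m]. *)
Lemma normc_hprod_eval (f : H -> C) x y (s : seq H) : uniq s ->
  (forall z, hconv x y z != 0 -> f z != 0 -> z \in s) ->
  normc (hprod_eval f x y) ^+ 2 <= \sum_(z <- s) hconv x y z * normc (f z) ^+ 2.
Proof.
move=> us hs; rewrite (hprod_evalE us hs).
set m := \sum_(z <- s) hconv x y z * normc (f z).
have hm : normc (\sum_(z <- s) (hconv x y z)%:C * f z) <= m.
  apply: le_trans (normc_sum _ _) _; apply: ler_sum => z _.
  by rewrite normcM normcR ger0_norm ?hconv_ge0.
have m0 : 0 <= m by apply: le_trans hm; exact: normc_ge0.
apply: (@le_trans _ _ (m ^+ 2)); first by rewrite ler_pXn2r ?nnegrE ?normc_ge0.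
have : 0 <= \sum_(z <- s) hconv x y z * (normc (f z) - m) ^+ 2.
  by rewrite sumr_ge0 // => z _; rewrite mulr_ge0 ?hconv_ge0 ?sqr_ge0.
have -> : \sum_(z <- s) hconv x y z * (normc (f z) - m) ^+ 2 =
    \sum_(z <- s) hconv x y z * normc (f z) ^+ 2 - 2 * m * m
    + (\sum_(z <- s) hconv x y z) * m ^+ 2.
  transitivity (\sum_(z <- s) (hconv x y z * normc (f z) ^+ 2
      + (- (2 * m)) * (hconv x y z * normc (f z)) + hconv x y z * m ^+ 2)).
    by apply: eq_bigr => z _; ring.
  by rewrite !big_split /= -mulr_sumr -mulr_suml -/m; ring.
have := ler_wpM2r (sqr_ge0 m) (hconv_sum_le1 x y us); lra.
Qed.

(** Jensen bounds |f(x.y)|^2 by an average over x.y; [hconv_lam_adj] trades the Haar weight at y for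
    the one at z, and the remaining masses of x~.z sum to at most 1. *)
Lemma T_contr x f : nrm ip (T x f) <= nrm ip f.
Proof.
rewrite ler_wsqrtr //.
have [s us hs] := fsf_support f; have [t ut ht] := fsf_support (T x f).
rewrite (N2E us hs) (N2E ut ht).
apply: (@le_trans _ _ (\sum_(y <- t) \sum_(z <- s) lam z * normc (f z) ^+ 2 * hconv (hinv x) z y)).
  apply: ler_sum => y _.
  apply: le_trans (ler_wpM2l (lam_ge0 y) (normc_hprod_eval us (fun z _ => @hs z))) _.
  rewrite mulr_sumr ler_sum // => z _; rewrite mulrA hconv_lam_adj.
  by rewrite mulrAC.
rewrite exchange_big; apply: ler_sum => z _ /=; rewrite -mulr_sumr.
by rewrite -[leRHS]mulr1 ler_wpM2l ?hconv_sum_le1 // mulr_ge0 ?lam_ge0 ?sqr_ge0.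
Qed.

End HypergroupFacts.

(** * Bilinear forms restricted to the diagonal *)

Section DiagonalBound.
Variables (R : realType) (H : discreteHypergroup R) (lam : H -> R).
Hypothesis Hcomm : hcommutative H.
Hypothesis Hhaar : left_haar lam.
Hypothesis Hnorm : lam (hunit H) = 1.
Local Notation C := R[i].
Local Notation e := (hunit H).
Local Notation V := (fsf H R).
Local Notation T := (translation Hcomm Hhaar Hnorm).
Local Notation ip := (ip lam).
Local Notation nrm := (nrm ip).
Local Notation N2 := (N2 ip).
Let ipP := ipP Hhaar Hnorm.
Let T_normal := T_normal Hcomm Hhaar Hnorm.
Let T_comm := T_comm Hcomm Hhaar Hnorm.
Let T_contr := T_contr Hcomm Hhaar Hnorm.

(** A matrix coefficient of the regular representation; [fconv_fstar] identifies [coef u u] with the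
    generators of [A_span]. *)
Definition coef (xi eta : V) (x : H) : C := ip (T x xi) eta.

Lemma coef_fsupp xi eta : coef xi eta \in @fsupp H R.
Proof.
have [s us [hs hs']] := fsf_support2 xi eta; apply/asboolP.
apply: (@sub_finite_set _ _ (\bigcup_(z in [set` s]) \bigcup_(y in [set` s])
  [set x | hconv z (hinv y) x != 0])); last first.
  by apply: bigcup_finite => // z _; apply: bigcup_finite => // y _; exact: hconv_fin.
move=> x /= h; apply: contrapT => hn; case/eqP: h.
rewrite /coef (ip_seqr _ _ us hs') big1_seq // => y /andP[_ ys].
rewrite TE (hprod_evalE us) => [|z _]; last exact: hs.
rewrite big1_seq ?mulr0 ?mul0r // => z /andP[_ zs].
suff -> : hconv x y z = 0 by rewrite mul0r.
apply: contrapT => /eqP h; apply: hn; exists z => //; exists y => //=.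
apply: contra h => /eqP h.
(* The vanishing of (z.y~)(x) passes to (x~.z)(y), then to (x.y)(z). *)
have h1 := hconv_lam_adj Hcomm Hhaar Hnorm (hinv z) x (hinv y).
have h2 := hconv_lam_adj Hcomm Hhaar Hnorm x y z.
rewrite hinvK h mulr0 hconvV hinvK in h1.
move/eqP: h1; rewrite mulf_eq0 (gt_eqF (lam_gt0 Hhaar Hnorm x)) /= => /eqP h1.
move: h2; rewrite h1 mulr0 => /eqP.
by rewrite mulf_eq0 (gt_eqF (lam_gt0 Hhaar Hnorm y)).
Qed.

Definition coefv (xi eta : V) : V := FSF (coef_fsupp xi eta).

Lemma conj_fsupp (f : V) : (fun x => (f x)^*%C) \in @fsupp H R.
Proof.
have [s us hs] := fsf_support f; apply/asboolP.
apply: (@sub_finite_set _ _ [set` s]) => // x /=.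
by rewrite conjc_eq0; exact: hs.
Qed.

Definition conjv (f : V) : V := FSF (conj_fsupp f).

Lemma mul_fsupp (f : V) (g : H -> C) : (fun x => f x * g x) \in @fsupp H R.
Proof.
have [s us hs] := fsf_support f; apply/asboolP.
apply: (@sub_finite_set _ _ [set` s]) => // x /=.
by rewrite mulf_eq0 negb_or => /andP[/hs].
Qed.

Definition mulv (f : V) (g : H -> C) : V := FSF (mul_fsupp f g).

Lemma delta_fsupp (a : H) : (fun x => (x == a)%:R) \in @fsupp H R.
Proof.
apply/asboolP; apply: (@sub_finite_set _ _ [set a]) => // x /=.
by rewrite pnatr_eq0 eqb0 negbK => /eqP.
Qed.

Definition delta (a : H) : V := FSF (delta_fsupp a).

Lemma deltaE a x : delta a x = (x == a)%:R. Proof. by []. Qed.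

Lemma delta_seq a x : delta a x != 0 -> x \in [:: a].
Proof. by rewrite deltaE inE pnatr_eq0 eqb0 negbK. Qed.

Lemma N2_conjv f : N2 (conjv f) = N2 f.
Proof.
have [s us hs] := fsf_support f.
rewrite (N2E _ us hs) (N2E _ us) => [|x]; last by rewrite conjc_eq0; exact: hs.
by apply: eq_bigr => x _; rewrite normc_conj.
Qed.

Lemma hprod_evalJ (f : H -> C) x y :
  (hprod_eval f x y)^*%C = hprod_eval (fun z => (f z)^*%C) x y.
Proof.
have [s us [hs _]] := hconv_seq x y.
rewrite !(hprod_evalE us) ?conjc_sum; [|by move=> z /hs..].
by apply: eq_bigr => z _; rewrite conjcM conjc_real.
Qed.

Lemma ip_conjv f g : ip (conjv f) (conjv g) = (ip f g)^*%C.
Proof.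
have [s us [hs hs']] := fsf_support2 f g.
rewrite (ip_seql _ _ us hs) (ip_seql _ _ us) => [|x]; last by rewrite conjc_eq0; exact: hs.
by rewrite conjc_sum; apply: eq_bigr => x _; rewrite !conjcM conjc_real.
Qed.

Lemma coef_conjv u x : coef (conjv u) (conjv u) x = (coef u u x)^*%C.
Proof.
have Tc : T x (conjv u) = conjv (T x u).
  by apply: fsf_eq => y; rewrite TE -[RHS]/((hprod_eval u x y)^*%C) hprod_evalJ.
by rewrite /coef Tc ip_conjv.
Qed.

Lemma coef_inv u x : coef u u (hinv x) = (coef u u x)^*%C.
Proof. by rewrite /coef T_adj hinvK (ip_sym ipP). Qed.

Lemma nrm_delta_e : nrm (delta e) = 1.
Proof.
rewrite /nrm (N2E _ (isT : uniq [:: e])) => [|x]; last exact: delta_seq.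
by rewrite big_seq1 deltaE eqxx Hnorm mul1r normc1 expr1n sqrtr1.
Qed.

(** The analogue of the orthogonality of characters for the Plancherel measure, whose role is played
    by the vector state at [delta e]. *)
Lemma coef_delta x y : ip (T x (T (hinv y) (delta e))) (delta e) = ((x == y)%:R / lam x)%:C.
Proof.
rewrite (ip_seqr _ _ (isT : uniq [:: e])) => [|z]; last exact: delta_seq.
rewrite big_seq1 deltaE eqxx Hnorm mul1r conjc1 mulr1 TE.
rewrite (@hprod_evalE _ _ _ _ _ [:: x]) // => [|z]; last first.
  by rewrite hconvx1 inE pnatr_eq0 eqb0 negbK.
rewrite big_seq1 hconvx1 eqxx mul1r TE.
rewrite (@hprod_evalE _ _ _ _ _ [:: e]) // => [|z _]; last exact: delta_seq.
rewrite big_seq1 deltaE eqxx mulr1; congr (_%:C).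
have [<-|xy] := eqVneq x y; first by rewrite (hconv_eE Hhaar Hnorm) mul1r.
by rewrite mul0r hconv_e0 // (inj_eq (can_inj (@hinvK _ H))) eq_sym.
Qed.

Lemma commutes_sum (I : Type) (l : seq I) (k : I -> C) (A : I -> V -> V) :
  (forall i, commutes_with T (A i)) ->
  commutes_with T (fun v => \sum_(i <- l) k i *: A i v).
Proof.
move=> hA; split=> [c u v|j v].
  rewrite scaler_sumr -big_split; apply: eq_bigr => i _ /=.
  have [lA _] := hA i; by rewrite lA scalerDr !scalerA mulrC.
have lT := normal_linear (T_normal j); rewrite (linear_sumE _ _ lT).
by apply: eq_bigr => i _; rewrite (linear_Z _ _ lT); have [_ ->] := hA i.
Qed.

Lemma commutes_TT x y : commutes_with T (fun v => T x (T y v)).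
Proof.
split; first by apply: linear_comp2; exact: normal_linear (T_normal _).
by move=> j v; rewrite [T y _]T_comm T_comm.
Qed.

(** * The operator attached to a kernel in two variables *)

Section TwoVariables.
Variables (l : seq (H * H)) (k : H * H -> C).

Definition opQ (v : V) : V := \sum_(p <- l) k p *: T p.1 (T (hinv p.2) v).
Definition opQ' (v : V) : V := \sum_(p <- l) (k p)^*%C *: T p.2 (T (hinv p.1) v).

Lemma opQ_comm : commutes_with T opQ.
Proof. by apply: commutes_sum => p; exact: commutes_TT. Qed.

Lemma opQ'_comm : commutes_with T opQ'.
Proof. by apply: commutes_sum => p; exact: commutes_TT. Qed.

Lemma opQ_normal : normal_pair ip opQ opQ'.
Proof.
have [lQ cQ] := opQ_comm; have [lQ' _] := opQ'_comm; split=> // [u v|u].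
  rewrite (ip_suml ipP) (ip_sumr ipP); apply: eq_bigr => p _.
  rewrite (ipZl ipP) (ipZr ipP) conjcK; congr (_ * _).
  by rewrite !T_adj hinvK.
rewrite {2}/opQ' (linear_sumE _ _ lQ); apply: eq_bigr => p _.
by rewrite (linear_Z _ _ lQ) !cQ.
Qed.

Lemma opQ_bound v : nrm (opQ v) <= (\sum_(p <- l) normc (k p)) * nrm v.
Proof.
apply: le_trans (ler_nrm_sum ipP _ _) _; rewrite mulr_suml ler_sum // => p _.
rewrite (nrmZ ipP) ler_wpM2l ?normc_ge0 //.
by apply: le_trans (T_contr _ _) (T_contr _ _).
Qed.

Lemma ip_opQ_delta : ip (opQ (delta e)) (delta e) =
  \sum_(p <- l) k p * ((p.1 == p.2)%:R / lam p.1)%:C.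
Proof.
rewrite (ip_suml ipP); apply: eq_bigr => p _.
by rewrite (ipZl ipP) coef_delta.
Qed.

Lemma opQ_eigen (u : V) (c : H -> C) (d : R) : nrm u = 1 -> (forall x, normc (c x) <= 1) ->
  (forall p, p \in l -> nrm (T p.1 u - c p.1 *: u) <= d) ->
  (forall p, p \in l -> nrm (T (hinv p.2) u - c (hinv p.2) *: u) <= d) ->
  nrm (opQ u - (\sum_(p <- l) k p * (c p.1 * c (hinv p.2))) *: u)
    <= (\sum_(p <- l) normc (k p)) * (2 * d).
Proof.
move=> u1 c1 h1 h2; rewrite scaler_suml -sumrB mulr_suml.
apply: le_trans (ler_nrm_sum ipP _ _) _; rewrite !big_seq ler_sum // => p pl.
rewrite -scalerA -scalerBr (nrmZ ipP) ler_wpM2l ?normc_ge0 //.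
set x := p.1; set y := hinv p.2.
have -> : T x (T y u) - (c x * c y) *: u =
    T x (T y u - c y *: u) + c y *: (T x u - c x *: u).
  rewrite (linear_scaleB _ _ _ (normal_linear (T_normal x))) scalerBr scalerA.
  by rewrite addrA subrK mulrC.
apply: le_trans (ler_nrmD ipP _ _) _; rewrite (nrmZ ipP).
have := le_trans (T_contr x _) (h2 _ pl); have := h1 _ pl; rewrite -/x -/y.
have := ler_pM (normc_ge0 (c y)) (nrm_ge0 ip (T x u - c x *: u)) (c1 y) (lexx _).
rewrite mul1r; lra.
Qed.

End TwoVariables.

(** An approximate eigenvalue says nothing about the Fourier norm, whereas [coef u u] does.
    Exchanging one for the other doubles the error. *)
Lemma coef_eigen (u : V) x (t : C) (d : R) : nrm u = 1 ->
  nrm (T x u - t *: u) <= d -> nrm (T x u - coef u u x *: u) <= 2 * d.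
Proof.
move=> u1 h.
have ct : normc (coef u u x - t) <= d.
  have -> : coef u u x - t = ip (T x u - t *: u) u.
    by rewrite (ipDl ipP) (ipNl ipP) (ipZl ipP) (ipuu ipP) -(sqr_nrm ipP) u1 expr1n mulr1.
  by apply: le_trans (normc_ip_le ipP _ _) _; rewrite u1 mulr1.
have -> : T x u - coef u u x *: u = (T x u - t *: u) - (coef u u x - t) *: u.
  by rewrite scalerBl opprB addrA subrK.
apply: le_trans (ler_nrmB ipP _ _) _; rewrite (nrmZ ipP) u1 mulr1; lra.
Qed.

Lemma coef_le1 (u : V) x : nrm u = 1 -> normc (coef u u x) <= 1.
Proof.
move=> u1; apply: le_trans (normc_ip_le ipP _ _) _.
by rewrite u1 mulr1 -u1 T_contr.
Qed.

Variable N : (H -> C) -> R.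
Hypothesis N_ge0 : forall f : V, 0 <= N f.
Hypothesis N_mul : forall f g : V, N (mulv f g) <= N f * N g.
Hypothesis N_coef : forall u, nrm u = 1 -> N (coefv u u) <= 1.

Definition supported (s : seq H) (f : V) := forall x, f x != 0 -> x \in s.

(** [m] is the matrix, on pairs of delta functions, of a bilinear form of norm at most [K]; only
    finitely supported arguments are tested. *)
Definition bform_bounded (m : H -> H -> C) (K : R) : Prop :=
  forall (a b : V) s, uniq s -> supported s a -> supported s b ->
  normc (\sum_(x <- s) \sum_(y <- s) a x * b y * m x y) <= K * N a * N b.

Definition dform_bounded (g : H -> C) (K : R) : Prop :=
  forall (a b : V) s, uniq s -> supported s a -> supported s b ->
  normc (\sum_(x <- s) a x * b x * g x) <= K * N a * N b.

Lemma diagonal_bound m K : 0 <= K -> bform_bounded m K ->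
  dform_bounded (fun x => m x x * ((lam x)^-1)%:C) K.
Proof.
move=> K0 hm a b s us sa sb.
pose l := [seq (x, y) | x <- s, y <- s].
pose k (p : H * H) := a p.1 * b p.2 * m p.1 p.2.
set s0 := (X in normc X <= _).
have s0E : s0 = ip (opQ l k (delta e)) (delta e).
  rewrite ip_opQ_delta big_allpairs; apply: eq_big_seq => x xs /=.
  rewrite (bigD1_seq x) //= big1 ?addr0; last first.
    by move=> y /negPf yx; rewrite eq_sym yx mul0r mulr0.
  by rewrite /k /= eqxx mul1r mulrA.
pose K' := K * N a * N b; rewrite -/K'.
have K'0 : 0 <= K' by rewrite !mulr_ge0.
have [Q0|Q0] := eqVneq (opQ l k (delta e)) 0.
  by rewrite s0E Q0 (ip0l ipP) normc0.
pose W := \sum_(p <- l) normc (k p).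
have W0 : 0 <= W by rewrite sumr_ge0 // => p _; exact: normc_ge0.
have main eps : 0 < eps -> normc s0 ^+ 2 <= (K' + W * (4 * eps)) ^+ 2 + eps.
  move=> eps0.
  (* Inverses are added to the list because [opQ] involves both T x and T y~. *)
  have [eta [eta0 hs hQ]] := joint_eigenvector_above ipP T_normal T_comm T_contr
    (s ++ [seq hinv x | x <- s]) (opQ_normal l k) (opQ_bound l k)
    (opQ_comm l k) (opQ'_comm l k) eps0 Q0.
  have neta := nrm_gt0 ipP eta0; have Neta := N2_gt0 ipP eta0.
  pose r : C := ((nrm eta)^-1)%:C; pose u := r *: eta.
  have rE : normc r = (nrm eta)^-1 by rewrite normcR ger0_norm // invr_ge0 ltW.
  have u1 : nrm u = 1 by rewrite (nrmZ ipP) rE mulVf // gt_eqF.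
  have eig (A : V -> V) c d : linear A ->
      nrm (A eta - c *: eta) <= d * nrm eta -> nrm (A u - c *: u) <= d.
    move=> lA hA; rewrite /u (linear_Z _ _ lA) scalerA mulrC -scalerA -scalerBr.
    rewrite (nrmZ ipP) rE mulrC ler_pdivrMr //.
  have lQ := normal_linear (opQ_normal l k).
  have hQu : N2 (opQ l k (delta e)) <= N2 (opQ l k u) + eps.
    have -> : N2 (opQ l k u) = N2 (opQ l k eta) / N2 eta.
      by rewrite /u (linear_Z _ _ lQ) (N2Z ipP) rE exprVn (sqr_nrm ipP) mulrC.
    rewrite -(ler_pM2r Neta) mulrDl divfK ?gt_eqF //; apply: le_trans hQ _.
    by rewrite -(sqr_nrm ipP (delta e)) nrm_delta_e expr1n mulr1.
  pose c := coef u u.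
  have hc x : x \in s ++ [seq hinv x | x <- s] -> nrm (T x u - c x *: u) <= 2 * eps.
    move=> /hs [t ht]; apply: coef_eigen => //.
    exact: eig (normal_linear (T_normal x)) ht.
  have hl p : p \in l -> p.1 \in s /\ p.2 \in s by move=> /allpairsP[[x y] /= [? ? ->]].
  set q := \sum_(p <- l) k p * (c p.1 * c (hinv p.2)).
  (* One doubling comes from [coef_eigen], the other from composing two translations. *)
  have hq : nrm (opQ l k u - q *: u) <= W * (2 * (2 * eps)).
    apply: opQ_eigen => // [x|p /hl[ps _]|p /hl[_ ps]].
    - exact: coef_le1.
    - by apply: hc; rewrite mem_cat ps.
    - by apply: hc; rewrite mem_cat map_f ?orbT.
  have qK : normc q <= K'.
    (* c (y~) is the conjugate of c y, hence a coefficient of the unit vector [conjv u]. Both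
       multipliers thus have norm at most 1. *)
    pose a' := mulv a (coefv u u); pose b' := mulv b (coefv (conjv u) (conjv u)).
    have -> : q = \sum_(x <- s) \sum_(y <- s) a' x * b' y * m x y.
      rewrite /q big_allpairs; apply: eq_bigr => x _; apply: eq_bigr => y _.
      have -> : b' y = b y * c (hinv y) by rewrite /c coef_inv -coef_conjv.
      have -> : a' x = a x * c x by [].
      change (a x * b y * m x y * (c x * c (hinv y)) = a x * c x * (b y * c (hinv y)) * m x y).
      by rewrite mulrAC; congr (_ * _); exact: mulrACA.
    apply: le_trans (hm _ _ _ us _ _) _.
    - by move=> x; rewrite mulf_eq0 negb_or => /andP[/sa].
    - by move=> x; rewrite mulf_eq0 negb_or => /andP[/sb].
    have cu : nrm (conjv u) = 1 by rewrite /nrm N2_conjv -/(nrm u).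
    rewrite /K' ler_pM ?mulr_ge0 // ?ler_wpM2l //.
      apply: le_trans (N_mul _ _) _; rewrite -[leRHS]mulr1 ler_wpM2l //; exact: N_coef.
    apply: le_trans (N_mul _ _) _; rewrite -[leRHS]mulr1 ler_wpM2l //; exact: N_coef.
  have s0Q : normc s0 ^+ 2 <= N2 (opQ l k (delta e)).
    rewrite -(sqr_nrm ipP) ler_pXn2r ?nnegrE ?normc_ge0 ?nrm_ge0 // s0E.
    by apply: le_trans (normc_ip_le ipP _ _) _; rewrite nrm_delta_e mulr1.
  have Qle : nrm (opQ l k u) <= K' + W * (4 * eps).
    have -> : opQ l k u = (opQ l k u - q *: u) + q *: u by rewrite subrK.
    apply: le_trans (ler_nrmD ipP _ _) _; rewrite (nrmZ ipP) u1 mulr1; lra.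
  apply: le_trans s0Q (le_trans hQu _); rewrite lerD2r -(sqr_nrm ipP).
  by rewrite ler_pXn2r ?nnegrE ?nrm_ge0 //; apply: le_trans Qle; exact: nrm_ge0.
rewrite leNgt; apply/negP => hlt.
pose d := normc s0 ^+ 2 - K' ^+ 2.
have d0 : 0 < d by rewrite subr_gt0 ltr_pXn2r ?nnegrE ?normc_ge0.
(* For eps <= 1 the right side of [main] is at most K'^2 + B eps, so eps <= d / (2 B) contradicts a
   gap d > 0. *)
pose B := 8 * W * K' + 16 * W ^+ 2 + 1.
have B0 : 0 < B by rewrite ltr_pwDr // addr_ge0 ?mulr_ge0 ?sqr_ge0.
pose eps := Num.min 1 (d / (2 * B)).
have eps0 : 0 < eps by rewrite lt_min ltr01 divr_gt0 // mulr_gt0.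
have eps1 : eps <= 1 by rewrite ge_min lexx.
have epsd : eps * B <= d / 2.
  have : eps <= d / (2 * B) by rewrite ge_min lexx orbT.
  by rewrite ler_pdivlMr ?mulr_gt0 //; lra.
have := main eps eps0.
have : (W * eps) ^+ 2 <= W ^+ 2 * eps.
  rewrite exprMn ler_wpM2l ?sqr_ge0 // expr2 -[leRHS]mulr1 ler_wpM2l // ltW //.
have := epsd; rewrite /B => h1 h2 h3.
have : d <= d / 2 by rewrite {1}/d; move: h1 h2 h3; clear; nra.
lra.
Qed.

(** Extension by zero turns a bounded diagonal form into a bounded bilinear form, so that
    [diagonal_bound] can be applied again and yield a further factor 1 / lam. *)
Lemma dform_offdiagonal g K : dform_bounded g K ->
  bform_bounded (fun x y => if x == y then g x else 0) K.
Proof.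
move=> hg a b s us sa sb.
have -> : \sum_(x <- s) \sum_(y <- s) a x * b y * (if x == y then g x else 0) =
    \sum_(x <- s) a x * b x * g x; last exact: hg.
apply: eq_big_seq => x xs; rewrite (bigD1_seq x) //= eqxx big1 ?addr0 // => y /negPf yx.
by rewrite eq_sym yx mulr0.
Qed.

Lemma dform_comb g g' (c : R) K K' : dform_bounded g K -> dform_bounded g' K' ->
  dform_bounded (fun x => g x + c%:C * g' x) (K + `|c| * K').
Proof.
move=> hg hg' a b s us sa sb.
have -> : \sum_(x <- s) a x * b x * (g x + c%:C * g' x) =
    (\sum_(x <- s) a x * b x * g x) + c%:C * \sum_(x <- s) a x * b x * g' x.
  rewrite mulr_sumr -big_split; apply: eq_bigr => x _ /=; ring.
apply: le_trans (le_normcD _ _) _; rewrite normcM normcR.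
have := hg a b s us sa sb; have := ler_wpM2l (normr_ge0 c) (hg' a b s us sa sb); lra.
Qed.

Lemma dform_ext g g' K : g =1 g' -> dform_bounded g K -> dform_bounded g' K.
Proof.
move=> e h a b s us sa sb; under eq_bigr do rewrite -e.
exact: h.
Qed.

(* If [lam] takes its values in [cs] the product vanishes, and the full diagonal
   of the form is bounded. *)
Lemma diagonal_interpolation (cs : seq R) : exists2 L : R, 0 <= L &
  forall m K, 0 <= K -> bform_bounded m K ->
  dform_bounded (fun x => m x x * (1 - \prod_(c <- cs) (1 - c / lam x))%:C) (L * K).
Proof.
elim: cs => [|c cs [L L0 IH]].
  exists 0 => // m K _ _; apply: (@dform_ext (fun=> 0)).
    by move=> x; rewrite big_nil subrr mulr0.
  move=> a b s _ _ _; rewrite big1 ?normc0 ?mul0r // => x _.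
  by rewrite mulr0.
exists (L + `|c| * 1 + `|c| * L) => [|m K K0 hm]; first by rewrite !addr_ge0 ?mulr_ge0.
(* With p the product over [cs], 1 - (1 - c / lam) p = (1 - p) + c / lam - c (1 - p) / lam. The
   three bounds serve the three terms, the last one by iteration. *)
have h1 := IH m K K0 hm.
have h2 := diagonal_bound K0 hm.
have h3 := diagonal_bound (mulr_ge0 L0 K0) (dform_offdiagonal h1).
have := dform_comb (- c) (dform_comb c h1 h2) h3; rewrite normrN => h.
have -> : (L + `|c| * 1 + `|c| * L) * K = L * K + `|c| * K + `|c| * (L * K) by ring.
apply: dform_ext h => x; rewrite eqxx big_cons.
set p := \prod_(_ <- _) _.
rewrite [in RHS](_ : 1 - (1 - c / lam x) * p = (1 - p) + c * (lam x)^-1 + (- c) * ((1 - p) * (lam x)^-1)); last by ring.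
rewrite !rmorphD !rmorphM /=; ring.
Qed.

End DiagonalBound.

(** * The Fourier algebra *)

Section Truncation.
Variables (R : realType) (H : discreteHypergroup R) (lam : H -> R).
Hypothesis Hhaar : left_haar lam.
Hypothesis Hnorm : lam (hunit H) = 1.
Local Notation C := R[i].
Local Notation V := (fsf H R).
Local Notation ip := (ip lam).
Local Notation nrm := (nrm ip).
Local Notation N2 := (N2 ip).
Let ipP := ipP Hhaar Hnorm.

Lemma trunc_fsupp (s : seq H) (g : H -> C) :
  (fun x => if x \in s then g x else 0) \in @fsupp H R.
Proof.
apply/asboolP; apply: (@sub_finite_set _ _ [set` s]) => // x /=.
by case: (x \in s) => //; rewrite eqxx.
Qed.

Definition truncv s g : V := FSF (trunc_fsupp s g).

Lemma truncvE s g x : truncv s g x = if x \in s then g x else 0. Proof. by []. Qed.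

Lemma truncv_seq s g x : truncv s g x != 0 -> x \in s.
Proof. by rewrite truncvE; case: (x \in s) => //; rewrite eqxx. Qed.

Lemma N2_truncv s g : uniq s ->
  N2 (truncv s g) = \sum_(x <- s) lam x * normc (g x) ^+ 2.
Proof.
move=> us; rewrite (N2E _ us) => [|x]; last exact: truncv_seq.
by apply: eq_big_seq => x xs; rewrite truncvE xs.
Qed.

Lemma sqr_ge0_lam (g : H -> C) x : 0 <= lam x * normc (g x) ^+ 2.
Proof. by rewrite mulr_ge0 ?sqr_ge0 ?(lam_ge0 Hhaar). Qed.

Lemma nrm_truncv_le s (g : V) : uniq s -> nrm (truncv s g) <= nrm g.
Proof.
move=> us; rewrite ler_wsqrtr // N2_truncv //.
have [t ut ht] := fsf_support g; rewrite (N2E _ ut ht).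
have -> : \sum_(x <- t) lam x * normc (g x) ^+ 2 =
    \sum_(x <- undup (s ++ t)) lam x * normc (g x) ^+ 2.
  have h x : lam x * normc (g x) ^+ 2 != 0 -> x \in t.
    by move=> hx; apply: ht; apply: contra hx => /eqP ->; rewrite normc0 expr0n mulr0.
  apply: sum_uniq_eq => //; first exact: undup_uniq.
  by move=> x /h xt; rewrite mem_undup mem_cat xt orbT.
apply: ler_sum_uniq => //; [exact: sqr_ge0_lam|exact: undup_uniq|].
by move=> x xs; rewrite mem_undup mem_cat xs.
Qed.

Lemma esum_fsf (g : V) :
  \esum_(x in [set: H]) (lam x * normc (g x) ^+ 2)%:E = (N2 g)%:E.
Proof.
have [t ut ht] := fsf_support g; rewrite (N2E _ ut ht).
apply: esum_seq => //; first exact: sqr_ge0_lam.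
by move=> x hx; apply: ht; apply: contra hx => /eqP ->; rewrite normc0 expr0n mulr0.
Qed.

Lemma L2_fsf (g : V) : L2 lam g.
Proof. by rewrite /L2 esum_fsf ltry. Qed.

Lemma norm2_fsf (g : V) : norm2 lam g = nrm g.
Proof. by rewrite /norm2 esum_fsf. Qed.

Lemma L2_bound (g : H -> C) (M : R) :
  (forall s, uniq s -> nrm (truncv s g) <= M) -> L2 lam g.
Proof.
move=> h; have M0 : 0 <= M by apply: le_trans (h [::] isT); exact: nrm_ge0.
apply: (@le_lt_trans _ _ (M ^+ 2)%:E); last exact: ltry.
apply: esum_le_seq => s us; rewrite -N2_truncv // -(sqr_nrm ipP).
by rewrite ler_pXn2r ?nnegrE ?nrm_ge0 ?h.
Qed.

Lemma nrm_truncv_norm2 (g : H -> C) s : uniq s -> L2 lam g ->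
  nrm (truncv s g) <= norm2 lam g.
Proof.
move=> us g2; rewrite ler_wsqrtr // N2_truncv // -lee_fin fineK.
  exact: esum_ge_seq (sqr_ge0_lam g) us.
rewrite ge0_fin_numE //; apply: esum_ge0 => x _; rewrite lee_fin; exact: sqr_ge0_lam.
Qed.

End Truncation.

Section FourierAlgebra.
Variables (R : realType) (H : discreteHypergroup R) (lam : H -> R).
Hypothesis Hcomm : hcommutative H.
Hypothesis Hhaar : left_haar lam.
Hypothesis Hnorm : lam (hunit H) = 1.
Local Notation C := R[i].
Local Notation e := (hunit H).
Local Notation V := (fsf H R).
Local Notation T := (translation Hcomm Hhaar Hnorm).
Local Notation ip := (ip lam).
Local Notation nrm := (nrm ip).
Local Notation N2 := (N2 ip).
Local Notation coef := (coef Hcomm Hhaar Hnorm).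
Local Notation coefv := (coefv Hcomm Hhaar Hnorm).
Let ipP := ipP Hhaar Hnorm.
Let T_normal := T_normal Hcomm Hhaar Hnorm.
Let T_contr := T_contr Hcomm Hhaar Hnorm.

(** Since (y~.x)~ = x~.y, both sides at x are the sum of lam y times u(y) times the conjugate of
    u(x~.y). *)
Lemma fconv_fstar (u : V) : fconv lam u (fstar u) = coef u u.
Proof.
apply/funext => x; have [s us hs] := fsf_support u.
rewrite /fconv /hint (csum_seq us) => [|y]; last first.
  by rewrite !mulf_eq0 !negb_or => /and3P[_ /hs].
have -> : coef u u x = ip u (T (hinv x) u) by rewrite /coef T_adj.
rewrite (ip_seql _ _ us hs); apply: eq_bigr => y _; rewrite mulrA; congr (_ * _).
rewrite TE hprod_evalJ.
rewrite (@hprod_evalE _ _ (fstar u) _ _ (map (@hinv _ H) s)); last 2 first.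
- by rewrite map_inj_uniq //; exact: can_inj (@hinvK _ H).
- by move=> z _; rewrite /fstar conjc_eq0 => /hs h; apply/mapP; exists (hinv z); rewrite ?hinvK.
rewrite big_map (hprod_evalE us) => [|z _]; last by rewrite conjc_eq0; exact: hs.
by apply: eq_bigr => z _; rewrite hconvV hinvK /fstar hinvK.
Qed.

(** Only finitely many y make y~.x meet the support of [z] for some x in [F]. The set found is
    independent of f and may be enlarged, so it can be shared with other sums. *)
Lemma fconv_seq (z : V) (F : seq H) : exists2 G : seq H, uniq G &
  forall G', uniq G' -> {subset G <= G'} -> forall (f : H -> C) x, x \in F ->
  fconv lam f z x = (\sum_(y <- G') ((lam y)%:C * f y) *: T (hinv y) z) x.
Proof.
have [s us hs] := fsf_support z.
have /finite_set_seq[G uG hG] : finite_set (\bigcup_(x in [set` F])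
    \bigcup_(w in [set` s]) [set y | hconv (hinv w) x y != 0]).
  by apply: bigcup_finite => // x _; apply: bigcup_finite => // w _; exact: hconv_fin.
exists G => // G' uG' GG' f x xF.
have -> : (\sum_(y <- G') ((lam y)%:C * f y) *: T (hinv y) z) x =
    \sum_(y <- G') (lam y)%:C * (f y * hprod_eval z (hinv y) x).
  by elim: G' {uG' GG'} => [|y G' IH]; rewrite ?big_nil // !big_cons fsfD IH fsfZ mulrA.
rewrite /fconv /hint (csum_seq uG') // => y; rewrite !mulf_eq0 !negb_or => /and3P[_ _ h].
apply/GG'/hG; exists x => //; apply: contrapT => hn; case/eqP: h.
rewrite (hprod_evalE us) => [|w _]; last exact: hs.
rewrite big1_seq // => w /andP[_ ws].
suff -> : hconv (hinv y) x w = 0 by rewrite mul0r.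
apply: contrapT => /eqP h; apply: hn; exists w => //=; apply: contra h => /eqP h.
have := hconv_lam_adj Hcomm Hhaar Hnorm x (hinv y) w.
rewrite hconvV hinvK h mulr0 => /eqP.
by rewrite mulf_eq0 (gt_eqF (lam_gt0 Hhaar Hnorm _)) /= Hcomm.
Qed.

Lemma L1_sum_le (f : H -> C) s : uniq s -> L1 lam f ->
  \sum_(x <- s) lam x * normc (f x) <=
  fine (\esum_(x in [set: H]) (lam x * normc (f x))%:E).
Proof.
move=> us f1; have f0 x : 0 <= lam x * normc (f x).
  by rewrite mulr_ge0 ?normc_ge0 ?(lam_ge0 Hhaar).
rewrite -lee_fin fineK; first exact: esum_ge_seq.
by rewrite ge0_fin_numE //; apply: esum_ge0 => x _; rewrite lee_fin.
Qed.

(** [norm2] takes [fine] of a possibly infinite sum and so bounds nothing outside [L2]. Finiteness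
    comes first, from the L^1 norm of f times the L^2 norm of z. *)
Lemma L2_fconv (f : H -> C) (z : V) : L1 lam f -> L2 lam (fconv lam f z).
Proof.
move=> f1; pose L := fine (\esum_(x in [set: H]) (lam x * normc (f x))%:E).
apply: (L2_bound Hhaar Hnorm) (L * nrm z) _ => F uF.
have [G uG hG] := fconv_seq z F.
have -> : truncv F (fconv lam f z) =
    truncv F (\sum_(y <- G) ((lam y)%:C * f y) *: T (hinv y) z).
  apply: fsf_eq => x; rewrite !truncvE; case: ifP => // xF.
  by rewrite (hG G).
apply: le_trans (nrm_truncv_le Hhaar _ uF) _.
apply: le_trans (ler_nrm_sum ipP _ _) _.
apply: le_trans _ (ler_wpM2r (nrm_ge0 ip z) (L1_sum_le uG f1)).
rewrite mulr_suml ler_sum // => y _; rewrite (nrmZ ipP) normcM normcR ger0_norm ?(lam_ge0 Hhaar) //.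
by rewrite ler_wpM2l // mulr_ge0 ?normc_ge0 ?(lam_ge0 Hhaar).
Qed.

Lemma nrm_fconv_le1 (f : H -> C) (z : V) s : uniq s -> L1 lam f ->
  (reduced_norm lam f <= 1)%E -> nrm z <= 1 -> nrm (truncv s (fconv lam f z)) <= 1.
Proof.
move=> us f1 rf z1; apply: le_trans (nrm_truncv_norm2 Hhaar us (L2_fconv z f1)) _.
rewrite -lee_fin; apply: le_trans rf; apply: ereal_sup_ubound; exists (z : H -> C) => //.
by split; [exact: L2_fsf|rewrite (norm2_fsf Hhaar)].
Qed.

(** The pairing with f equals <u, conj(f . conj u)>, to which Cauchy-Schwarz applies. The
    conjugations arise because the pairing is bilinear and [ip] is sesquilinear. *)
Lemma dual_norm_coef (u : V) : nrm u <= 1 ->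
  (dual_norm lam (reduced_norm lam) (coef u u) <= 1)%E.
Proof.
move=> u1; apply: ge_ereal_sup => _ [f [f1 rf] <-]; rewrite lee_fin.
have [s us hs] := fsf_support u; have [G uG hG] := fconv_seq (conjv u) s.
have [t ut ht] := fsf_support (coefv u u).
pose G' := undup (G ++ t); have uG' : uniq G' by exact: undup_uniq.
have GG' : {subset G <= G'} by move=> x xG; rewrite mem_undup mem_cat xG.
rewrite /hint (csum_seq uG') => [|x]; last first.
  rewrite mulf_eq0 negb_or => /andP[_ h]; rewrite mem_undup mem_cat ht ?orbT //.
  by apply: contra h => /eqP h; rewrite -[X in X == 0]/(coefv u u x * f x) h mul0r.
have -> : \sum_(x <- G') (lam x)%:C * (coef u u * f) x =
    ip u (conjv (truncv s (fconv lam f (conjv u)))).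
  rewrite (ip_seql _ _ us hs).
  have -> : \sum_(y <- s) (lam y)%:C * u y *
      (conjv (truncv s (fconv lam f (conjv u))) y)^*%C =
    \sum_(y <- s) \sum_(x <- G') (lam x)%:C * f x * ((lam y)%:C * u y * T (hinv x) (conjv u) y).
    apply: eq_big_seq => y ys; rewrite conjcK truncvE ys (hG _ uG' GG' f _ ys).
    have -> : (\sum_(x <- G') ((lam x)%:C * f x) *: T (hinv x) (conjv u)) y =
        \sum_(x <- G') (lam x)%:C * f x * T (hinv x) (conjv u) y.
      by elim: (G') => [|x l IH]; rewrite ?big_nil // !big_cons fsfD IH fsfZ.
    by rewrite mulr_sumr; apply: eq_bigr => x _; rewrite mulrCA.
  rewrite exchange_big; apply: eq_bigr => x _ /=; rewrite -mulr_sumr.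
  rewrite -mulrA; congr (_ * _).
  rewrite -[LHS]/(coef u u x * f x) mulrC; congr (_ * _).
  rewrite /coef T_adj (ip_seql _ _ us hs); apply: eq_bigr => y _.
  by rewrite !TE hprod_evalJ.
apply: le_trans (normc_ip_le ipP _ _) _.
rewrite -[leRHS]mulr1 ler_pM ?nrm_ge0 //.
rewrite /nrm N2_conjv; apply: nrm_fconv_le1 => //.
by rewrite /nrm N2_conjv.
Qed.

Local Notation A := (A_space lam).
Local Notation N := (Blam_norm lam).
Hypothesis Hreg : regular_fourier lam.

Lemma norm_zero : N 0 = 0.
Proof.
have := balg_normZ Hreg 0 (balg0 Hreg); rewrite scale0r => ->.
by rewrite normc0 mul0r.
Qed.

Lemma norm_opp a : A a -> N (- a) = N a.
Proof. by move=> Aa; rewrite -scaleN1r (balg_normZ Hreg) // normcN normc1 mul1r. Qed.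

Lemma A_scale c a : A a -> A (c *: a).
Proof. by move=> Aa; rewrite -[c *: a]addr0; apply: (balg_linear Hreg) => //; exact: balg0 Hreg. Qed.

Lemma A_add a b : A a -> A b -> A (a + b).
Proof. by move=> Aa Ab; rewrite -[a]scale1r; exact: (balg_linear Hreg). Qed.

Lemma A_opp a : A a -> A (- a).
Proof. by rewrite -scaleN1r; exact: A_scale. Qed.

Lemma norm_ge0 a : A a -> 0 <= N a.
Proof.
move=> Aa; have := balg_normD Hreg Aa (A_opp Aa).
by rewrite subrr norm_zero norm_opp // -mulr2n pmulrn_lge0.
Qed.

Lemma norm_coef (u : V) : nrm u <= 1 -> N (coef u u) <= 1.
Proof.
move=> /dual_norm_coef; rewrite /Blam_norm.
by case: (dual_norm _ _ _) => [r||] //=; rewrite lee_fin.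
Qed.

Lemma fsf_bounded (f : V) : exists M : R, forall x, normc (f x) <= M.
Proof.
have [s us hs] := fsf_support f; exists (\sum_(x <- s) normc (f x)) => x.
have [xs|xs] := boolP (x \in s).
  rewrite (bigD1_seq x) //= lerDl sumr_ge0 // => y _; exact: normc_ge0.
rewrite (fsf0_out hs xs) normc0 sumr_ge0 // => y _; exact: normc_ge0.
Qed.

Lemma A_coef1 (u : V) : nrm u <= 1 -> A (coef u u).
Proof.
move=> u1; split.
  split; first exact: (fsf_bounded (coefv u u)).
  by apply: le_lt_trans (dual_norm_coef u1) _; exact: ltry.
move=> eps eps0; exists (coef u u); split; last by rewrite subrr norm_zero.
exists 1%N, (fun=> 1), (fun=> u : H -> C); split=> [_|].
  by have /asboolP := fsf_valP u.
by rewrite big_ord1 scale1r fconv_fstar.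
Qed.

Lemma A_coefuu (u : V) : A (coef u u).
Proof.
pose k := nrm u + 1; have k0 : 0 < k by rewrite ltr_wpDl ?nrm_ge0.
have ku : nrm ((k^-1)%:C *: u) <= 1.
  rewrite (nrmZ ipP) normcR ger0_norm ?invr_ge0 ?(ltW k0) // mulrC.
  by rewrite ler_pdivrMr // mul1r lerDl.
have -> : coef u u = (k ^+ 2)%:C *: coef ((k^-1)%:C *: u) ((k^-1)%:C *: u).
  apply/funext => x; rewrite -[RHS]/((k ^+ 2)%:C * coef _ _ x) /coef.
  rewrite (linear_Z _ _ (normal_linear (T_normal x))) (ipZl ipP) (ipZr ipP) conjc_real.
  rewrite !mulrA -!rmorphM /= -mulrA -expr2 -exprMn divff ?gt_eqF //.
  by rewrite expr1n mul1r.
by apply: A_scale; exact: A_coef1.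
Qed.

(** Polarization over the fourth roots of unity. *)
Lemma A_coef (u v : V) : A (coef u v).
Proof.
pose w (c : C) := coef (u + c *: v) (u + c *: v).
have wE c x : w c x = coef u u x + c^*%C * coef u v x + c * coef v u x + c * c^*%C * coef v v x.
  rewrite /w /coef; have lT := normal_linear (T_normal x).
  have -> : T x (u + c *: v) = T x u + c *: T x v by rewrite addrC lT addrC.
  by rewrite !(ipDl ipP) !(ipDr ipP) !(ipZl ipP) !(ipZr ipP); ring.
have -> : coef u v = (4^-1)%:C *: (w 1 + 'i *: w 'i + (-1) *: w (-1) + (- 'i) *: w (- 'i)).
  apply/funext => x.
  rewrite -[RHS]/((4^-1)%:C * (w 1 x + 'i * w 'i x + (-1) * w (-1) x + (- 'i) * w (- 'i) x)).
  rewrite !wE; move: (coef u u x) (coef u v x) (coef v u x) (coef v v x) => [a a'] [b b'] [c c'] [d d'].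
  by apply/eqP; rewrite eq_complex /=; apply/andP; split; apply/eqP; field.
by apply/A_scale; do ![apply: A_add|apply: A_scale|exact: A_coefuu].
Qed.

(** As a coefficient of [delta e] against [delta (hinv a)]: the Haar weight of a~ cancels the mass 1
    / lam a of a.a~ at the unit. *)
Lemma A_delta a : A (delta a).
Proof.
have -> : (delta a : H -> C) = coef (delta e) (delta (hinv a)); last exact: A_coef.
apply/funext => x; rewrite /coef.
rewrite (ip_seqr _ _ (isT : uniq [:: hinv a])) => [|y]; last exact: delta_seq.
rewrite big_seq1 deltaE deltaE eqxx conjc1 mulr1 TE (lam_inv Hcomm Hhaar Hnorm).
rewrite (@hprod_evalE _ _ _ _ _ [:: e]) // => [|z _]; last exact: delta_seq.
rewrite big_seq1 deltaE eqxx mulr1 -rmorphM /= Hcomm.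
have [->|xa] := eqVneq x a.
  by rewrite (hconv_eE Hhaar Hnorm) divff // lt0r_neq0 // (lam_gt0 Hhaar Hnorm).
by rewrite hconv_e0 ?mulr0 // (inj_eq (can_inj (@hinvK _ H))) eq_sym.
Qed.

Lemma fsf_delta (f : V) s : uniq s -> (forall x, f x != 0 -> x \in s) ->
  (f : H -> C) = \sum_(x <- s) f x *: (delta x : H -> C).
Proof.
move=> us hs; apply/funext => y.
have -> : (\sum_(x <- s) f x *: (delta x : H -> C)) y = \sum_(x <- s) f x * (y == x)%:R.
  by elim: (s) => [|x l IH]; rewrite ?big_nil // !big_cons -IH.
have [ys|ys] := boolP (y \in s).
  rewrite (bigD1_seq y) //= eqxx mulr1 big1 ?addr0 // => x /negPf xy.
  by rewrite eq_sym xy mulr0.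
rewrite (fsf0_out hs ys) big1_seq // => x /andP[_ xs].
rewrite (_ : (y == x) = false) ?mulr0 //; by apply: contraNF ys => /eqP ->.
Qed.

Lemma A_sum (I : Type) (s : seq I) (F : I -> H -> C) : (forall i, A (F i)) -> A (\sum_(i <- s) F i).
Proof. move=> h; elim/big_ind: _ => //; [exact: balg0 Hreg|exact: A_add]. Qed.

Lemma A_fsf (f : V) : A f.
Proof.
have [s us hs] := fsf_support f; rewrite (fsf_delta us hs).
by apply: A_sum => x; apply: A_scale; exact: A_delta.
Qed.

Lemma norm_sum_le (I : Type) (s : seq I) (F : I -> H -> C) : (forall i, A (F i)) ->
  N (\sum_(i <- s) F i) <= \sum_(i <- s) N (F i).
Proof.
move=> h; elim: s => [|i s IH]; first by rewrite !big_nil norm_zero.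
rewrite !big_cons; apply: le_trans (balg_normD Hreg _ _) _; [exact: h|exact: A_sum|].
by rewrite lerD2l.
Qed.

(** The generators of [A_span] are coefficients of finitely supported functions, hence finitely
    supported themselves. *)
Lemma A_density a (eps : R) : A a -> 0 < eps -> exists f : V, N (a - f) < eps.
Proof.
move=> [_ h] eps0; have [v [[n [c [xi [xis ->]]]] hv]] := h eps eps0.
have xiP i : xi i \in @fsupp H R by apply/asboolP.
exists (\sum_(i < n) c i *: coefv (FSF (xiP i)) (FSF (xiP i))).
set w := (X in a - X) in hv; set w' := (X in a - X); suff -> : w' = w by [].
have Ei i : fconv lam (xi i) (fstar (xi i)) = coefv (FSF (xiP i)) (FSF (xiP i)).
  exact: (fconv_fstar (FSF (xiP i))).
have E (l : seq 'I_n) : fsf_val (\sum_(i <- l) c i *: coefv (FSF (xiP i)) (FSF (xiP i))) =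
    \sum_(i <- l) c i *: fconv lam (xi i) (fstar (xi i)).
  by elim: l => [|i l IH]; rewrite ?big_nil // !big_cons -IH Ei.
exact: E.
Qed.

End FourierAlgebra.

(** * Approximate units from (P2) *)

Section ApproximateIdentity.
Variables (R : realType) (H : discreteHypergroup R) (lam : H -> R).
Hypothesis Hcomm : hcommutative H.
Hypothesis Hhaar : left_haar lam.
Hypothesis Hnorm : lam (hunit H) = 1.
Local Notation C := R[i].
Local Notation V := (fsf H R).
Local Notation T := (translation Hcomm Hhaar Hnorm).
Local Notation ip := (ip lam).
Local Notation nrm := (nrm ip).
Local Notation N2 := (N2 ip).
Local Notation coef := (coef Hcomm Hhaar Hnorm).
Let ipP := ipP Hhaar Hnorm.
Let T_contr := T_contr Hcomm Hhaar Hnorm.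

Lemma truncvB s (f g : H -> C) : truncv s (f - g) = truncv s f - truncv s g.
Proof.
apply: fsf_eq => x; rewrite -[RHS]/(truncv s f x - truncv s g x) !truncvE.
by case: ifP; rewrite ?subr0.
Qed.

(** Contractivity of translations beyond finite support: on [F] the translate sees [g] only on a
    finite set, outside which [g] may be cut off. *)
Lemma nrm_truncv_hprod (g : H -> C) x (M : R) F : uniq F ->
  (forall s, uniq s -> nrm (truncv s g) <= M) ->
  nrm (truncv F (hprod_eval g x)) <= M.
Proof.
move=> uF hM; have /finite_set_seq[s us hs] : finite_set (\bigcup_(z in [set` F])
    [set w | hconv x z w != 0]) by apply: bigcup_finite => // z _; exact: hconv_fin.
have -> : truncv F (hprod_eval g x) = truncv F (T x (truncv s g)).
  apply: fsf_eq => z; rewrite !truncvE; case: ifP => // zF; rewrite TE.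
  rewrite !(hprod_evalE us) => [|w h _|w h _]; try by apply: hs; exists z.
  by apply: eq_big_seq => w ws; rewrite truncvE ws.
apply: le_trans (nrm_truncv_le Hhaar _ uF) _.
exact: le_trans (T_contr _ _) (hM _ us).
Qed.

Lemma ip_truncv F (w u : V) : uniq F -> (forall x, u x != 0 -> x \in F) ->
  ip w u = ip (truncv F w) u.
Proof.
move=> uF hu; rewrite !(ip_seqr _ _ uF hu).
by apply: eq_big_seq => x xF; rewrite truncvE xF.
Qed.

Lemma coef_almost_invariant (xi : H -> C) (d : R) : L2 lam xi -> norm2 lam xi = 1 ->
  0 < d -> d <= 1 -> exists2 u : V, nrm u <= 1 & forall x,
  norm2 lam (ltrans (hinv x) xi - xi) < d -> normc (coef u u x - 1) < 4 * d.
Proof.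
move=> xi2 xi1 d0 d1.
have f0 : forall x, 0 <= lam x * normc (xi x) ^+ 2 := sqr_ge0_lam Hhaar xi.
have E1 : \esum_(x in [set: H]) (lam x * normc (xi x) ^+ 2)%:E = 1%:E.
  have fE : \esum_(x in [set: H]) (lam x * normc (xi x) ^+ 2)%:E \is a fin_num.
    by rewrite ge0_fin_numE //; apply: esum_ge0 => x _; rewrite lee_fin.
  rewrite -(fineK fE); congr (_%:E).
  have f1 : 0 <= fine (\esum_(x in [set: H]) (lam x * normc (xi x) ^+ 2)%:E).
    by apply/fine_ge0/esum_ge0 => x _; rewrite lee_fin.
  by rewrite -(sqr_sqrtr f1) -[Num.sqrt _]/(norm2 lam xi) xi1 expr1n.
(* Leaving out mass less than d^2 gives every truncation of the tail [g] norm at most d. *)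
have [F uF hF] : exists2 F, uniq F & 1 - d ^+ 2 < \sum_(x <- F) lam x * normc (xi x) ^+ 2.
  by apply: esum_gt_seq; rewrite E1 lte_fin ltrBlDr ltrDl exprn_gt0.
pose u := truncv F xi; pose g : H -> C := xi - u.
have N2u : N2 u = \sum_(x <- F) lam x * normc (xi x) ^+ 2 by rewrite N2_truncv.
have xin s : uniq s -> nrm (truncv s xi) <= 1.
  by move=> us; rewrite -xi1; exact: nrm_truncv_norm2.
have gn s : uniq s -> nrm (truncv s g) <= d.
  move=> us; rewrite -(@ler_pXn2r _ 2) ?nnegrE ?nrm_ge0 ?(ltW d0) // (sqr_nrm ipP) N2_truncv //.
  have -> : \sum_(x <- s) lam x * normc (g x) ^+ 2 =
      \sum_(x <- [seq x <- s | x \notin F]) lam x * normc (xi x) ^+ 2.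
    rewrite big_filter [RHS]big_mkcond; apply: eq_bigr => x _.
    have -> : g x = xi x - u x by [].
    by rewrite truncvE; case: (x \in F); rewrite ?subrr ?subr0 // normc0 expr0n mulr0.
  have /(esum_ge_seq f0) : uniq ([seq x <- s | x \notin F] ++ F).
    rewrite cat_uniq filter_uniq // uF andbT; apply/hasPn => x xF.
    by rewrite mem_filter xF.
  rewrite E1 lee_fin big_cat /=; lra.
exists u; first exact: xin.
move=> x hx; set h := ltrans _ _ - _ in hx.
have hE : h = hprod_eval xi x - xi by rewrite /h /ltrans hinvK.
have hh : forall s, uniq s -> nrm (truncv s h) <= d.
  move=> s us; apply: le_trans (ltW hx); apply: nrm_truncv_norm2 => //.
  apply: (@L2_bound _ _ _ Hhaar Hnorm _ 2) => t ut; rewrite hE truncvB.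
  apply: le_trans (ler_nrmB ipP _ _) _.
  by have := nrm_truncv_hprod x ut xin; have := xin _ ut; lra.
(* T x u - u is (T x xi - xi) minus T x g on [F], where [u] and [xi] agree. *)
have Tu : truncv F (T x u - u : V) = truncv F h - truncv F (hprod_eval g x).
  apply: fsf_eq => z.
  rewrite -[RHS]/(truncv F h z - truncv F (hprod_eval g x) z) !truncvE.
  case: ifP => zF; last by rewrite subr0.
  have -> : (T x u - u : V) z = hprod_eval u x z - u z by [].
  rewrite truncvE zF hE.
  have -> : (hprod_eval xi x - xi) z = hprod_eval xi x z - xi z by [].
  have {2}-> : xi = 1 *: g + u by rewrite scale1r /g subrK.
  rewrite hprod_eval_linear; ring.
(* The inner product is at most 2 d, and N2 u falls short of 1 by less than d^2 <= d. *)
have -> : coef u u x - 1 = ip (truncv F h - truncv F (hprod_eval g x)) u + (N2 u - 1)%:C.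
  rewrite -Tu -(ip_truncv _ uF); last by move=> z; exact: truncv_seq.
  rewrite (ipDl ipP) (ipNl ipP) (ipuu ipP) rmorphB /= /coef; ring.
apply: le_lt_trans (le_normcD _ _) _; rewrite normcR.
have N2u1 : N2 u <= 1.
  by rewrite -(sqr_nrm ipP) expr_le1 ?nrm_ge0 //; exact: xin.
rewrite ler0_norm ?subr_le0 //.
have h1 : normc (ip (truncv F h - truncv F (hprod_eval g x)) u) <= 2 * d.
  apply: le_trans (normc_ip_le ipP _ _) _.
  rewrite -[leRHS]mulr1; apply: ler_pM (nrm_ge0 _ _) (nrm_ge0 _ _) _ (xin _ uF).
  apply: le_trans (ler_nrmB ipP _ _) _.
  by have := hh _ uF; have := nrm_truncv_hprod x uF gn; lra.
have d2 : d ^+ 2 <= d by rewrite expr2 -[leRHS]mulr1 ler_wpM2l // ltW.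
move: hF; rewrite -N2u; lra.
Qed.

Lemma approximate_units (S : seq H) (eps : R) : property_P2 lam -> 0 < eps ->
  exists2 u : V, nrm u <= 1 & forall x, x \in S -> normc (coef u u x - 1) < eps.
Proof.
move=> [I [le [xi [[i00] [le_refl le_tr] le_dir hxi hinvt]]]] eps0.
pose d := Num.min 1 (eps / 4).
have d0 : 0 < d by rewrite lt_min ltr01 divr_gt0.
have d1 : d <= 1 by rewrite ge_min lexx.
have d4 : 4 * d <= eps by rewrite mulrC -ler_pdivlMr // ge_min lexx orbT.
have [i hi] : exists i, forall x, x \in S -> norm2 lam (ltrans (hinv x) (xi i) - xi i) < d.
  suff [i0 h] : exists i0, forall i, le i0 i -> forall x, x \in S ->
      norm2 lam (ltrans (hinv x) (xi i) - xi i) < d by exists i0; exact: h.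
  elim: S => [|x S [i1 h1]]; first by exists i00.
  have [i2 h2] := hinvt (hinv x) d d0; have [k [k1 k2]] := le_dir i1 i2.
  exists k => i ki y; rewrite inE => /orP[/eqP ->|yS]; first exact/h2/(le_tr _ _ _ k2).
  exact: h1 (le_tr _ _ _ k1 ki) _ yS.
have [_ xi2 xi1] := hxi i.
have [u u1 hu] := coef_almost_invariant xi2 xi1 d0 d1.
exists u => // x xS; exact: lt_le_trans (hu x (hi x xS)) d4.
Qed.

End ApproximateIdentity.

(** * Limits along an ultrafilter *)

Section UltraLimits.
Variables (R : realType) (W : Type) (U : set_system W).
Hypothesis UU : UltraFilter U.
Local Notation C := R[i].
Implicit Types f g : W -> C.

Definition ulim f (l : C) : Prop :=
  forall eps : R, 0 < eps -> U [set u | normc (f u - l) < eps].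

Definition ubounded f (M : R) : Prop := U [set u | normc (f u) <= M].

(** The default 0 is taken only when there is no limit; [LIMP] excludes this for functions bounded
    on a set of [U]. *)
Definition LIM f : C := xget 0 [set l | ulim f l].

(** Compactness of [-M, M] gives a cluster point, and a cluster point of an ultrafilter is a limit,
    since each set or its complement belongs to it. *)
Lemma real_ultra_limit (h : W -> R) (M : R) : U [set u | `|h u| <= M] ->
  exists l : R, forall eps : R, 0 < eps -> U [set u | `|h u - l| < eps].
Proof.
move=> hM; have cM : compact `[-M, M] by exact: segment_compact.
have [|l [_ cl]] := cM (h @ U) _.
  rewrite /fmap /=; apply: filterS hM => u /=.
  by rewrite in_itv /= ler_norml.
exists l => eps eps0.
have [//|hc] := in_ultra_setVsetC [set u | `|h u - l| < eps] UU.
have : U (h @^-1` (h @` (~` [set u | `|h u - l| < eps]))).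
  by apply: filterS hc => u hu; exists u.
move=> /cl /(_ (nbhsx_ballx l eps eps0)) [_ [[u hu <-]]].
rewrite /ball /= distrC => hb; by case: hu.
Qed.

Lemma normc_le_ReIm (z : C) : normc z <= `|complex.Re z| + `|complex.Im z|.
Proof.
have -> : z = (complex.Re z)%:C + 'i * (complex.Im z)%:C.
  by case: z => a b; apply/eqP; rewrite eq_complex /=; apply/andP; split; apply/eqP; ring.
set a := complex.Re z; set b := complex.Im z.
apply: le_trans (le_normcD _ _) _; rewrite normcM !normcR.
have -> : normc ('i : C) = 1 by rewrite /= expr0n expr1n add0r sqrtr1.
by rewrite mul1r /= !mul0r !mul1r !subr0 !addr0 ?add0r.
Qed.

Lemma normc_Im_le (z : C) : `|complex.Im z| <= normc z.
Proof. by case: z => a b /=; rewrite -sqrtr_sqr ler_wsqrtr // lerDr sqr_ge0. Qed.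

Lemma normc_Re_le (z : C) : `|complex.Re z| <= normc z.
Proof. by case: z => a b /=; rewrite -sqrtr_sqr ler_wsqrtr // lerDl sqr_ge0. Qed.

Lemma ulim_exists f M : ubounded f M -> exists l, ulim f l.
Proof.
move=> fM.
have [|a ha] := @real_ultra_limit (fun u => complex.Re (f u)) M.
  by apply: filterS fM => u /=; apply: le_trans; exact: normc_Re_le.
have [|b hb] := @real_ultra_limit (fun u => complex.Im (f u)) M.
  by apply: filterS fM => u /=; apply: le_trans; exact: normc_Im_le.
exists (a +i* b) => eps eps0.
have e2 : 0 < eps / 2 by rewrite divr_gt0.
apply: filterS2 (ha _ e2) (hb _ e2) => u /= h1 h2.
apply: le_lt_trans (normc_le_ReIm _) _.
by move: h1 h2; case: (f u) => x y /= h1 h2; lra.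
Qed.

Lemma ulim_bound f l M : ulim f l -> ubounded f M -> normc l <= M.
Proof.
move=> fl fM; rewrite leNgt; apply/negP => h.
have e0 : 0 < normc l - M by rewrite subr_gt0.
have [u [/= h1 h2]] := filter_ex (filterI (fl _ e0) fM).
have : normc l <= normc (f u) + normc (f u - l).
  by rewrite [normc (f u - l)]normcB -{1}(subrK (f u) l) addrC; exact: le_normcD.
by move: h1 h2; lra.
Qed.

Lemma ulimD f g l k (c : C) : ulim f l -> ulim g k -> ulim (fun u => c * f u + g u) (c * l + k).
Proof.
move=> fl gk eps eps0; pose M := normc c + 1.
have M0 : 0 < M by rewrite ltr_wpDl ?normc_ge0.
have e1 : 0 < eps / 2 / M by rewrite !divr_gt0.
have e2 : 0 < eps / 2 by rewrite divr_gt0.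
apply: filterS2 (fl _ e1) (gk _ e2) => u /= h1 h2.
have -> : c * f u + g u - (c * l + k) = c * (f u - l) + (g u - k) by ring.
apply: le_lt_trans (le_normcD _ _) _; rewrite normcM.
have : normc c * normc (f u - l) <= eps / 2.
  rewrite -[leRHS](divfK (lt0r_neq0 M0)).
  rewrite [leRHS]mulrC ler_pM ?normc_ge0 //; first by rewrite lerDl.
  exact: ltW.
by move: h2; lra.
Qed.

Lemma ulim_uniq f l k : ulim f l -> ulim f k -> l = k.
Proof.
move=> fl fk; have h := ulimD (-1) fl fk.
have hb (eps : R) : 0 < eps -> normc (-1 * l + k) <= eps.
  move=> eps0; apply: (ulim_bound h); rewrite /ubounded.
  by apply: filterS filterT => u _ /=; rewrite mulN1r addNr normc0 ltW.
apply/eqP; rewrite eq_sym -subr_eq0; apply/eqP/eq0_normc/eqP.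
rewrite eq_le normc_ge0 andbT; apply/ler_addgt0Pl => eps eps0.
by rewrite addr0 [k - l]addrC -mulN1r; exact: hb.
Qed.

Lemma LIMP f M : ubounded f M -> ulim f (LIM f).
Proof. by move=> /ulim_exists fl; rewrite /LIM; case: xgetP => // /(_ _ _) h; case: fl => l /h. Qed.

Lemma LIM_eq f l : ulim f l -> LIM f = l.
Proof. by move=> fl; rewrite /LIM; apply: xget_unique => // k /ulim_uniq; apply. Qed.

Lemma LIM_bound f M : ubounded f M -> normc (LIM f) <= M.
Proof. by move=> fM; apply: ulim_bound (LIMP fM) fM. Qed.

Lemma LIM_linear f g M M' (c : C) : ubounded f M -> ubounded g M' ->
  LIM (fun u => c * f u + g u) = c * LIM f + LIM g.
Proof. by move=> /LIMP fl /LIMP gl; apply: LIM_eq; exact: ulimD. Qed.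

Lemma LIM_cst l : LIM (fun=> l) = l.
Proof.
by apply: LIM_eq => eps eps0; apply: filterS filterT => u _ /=; rewrite subrr normc0.
Qed.

End UltraLimits.

(** * Derivations *)

Section Amenability.
Variables (R : realType) (H : discreteHypergroup R) (lam : H -> R).
Hypothesis Hcomm : hcommutative H.
Hypothesis Hhaar : left_haar lam.
Hypothesis Hnorm : lam (hunit H) = 1.
Hypothesis Hreg : regular_fourier lam.
Local Notation C := R[i].
Local Notation V := (fsf H R).
Local Notation A := (A_space lam).
Local Notation N := (Blam_norm lam).
Let A_fsf := A_fsf Hcomm Hhaar Hnorm Hreg.
Let A_delta := A_delta Hcomm Hhaar Hnorm Hreg.
Let A_sub a b : A a -> A b -> A (a - b).
Proof. by move=> Aa Ab; exact: A_add Hreg _ _ Aa (A_opp Hreg Ab). Qed.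

(* The diagonal [\sum_x u(x) delta_x (x) delta_x] has projective tensor norm at most [L],
   stated by duality with bounded bilinear forms. *)
Definition good_unit (L : R) (u : V) : Prop :=
  N u <= 1 /\ forall m K s, 0 <= K -> bform_bounded N m K -> uniq s ->
    supported s u -> normc (\sum_(x <- s) u x * m x x) <= L * K.

(** Squaring fits the two arguments of [dform_bounded]: both are the coefficient [w], of norm at
    most 1. *)
Lemma good_unit_near L : 0 <= L ->
  (forall m K, 0 <= K -> bform_bounded N m K ->
     dform_bounded N (fun x => m x x) (L * K)) ->
  property_P2 lam -> forall (S : seq H) (eps : R), 0 < eps ->
  exists2 u, good_unit L u & forall x, x \in S -> normc (u x - 1) < eps.
Proof.
(* |z^2 - 1| <= |z - 1|^2 + 2 |z - 1| <= 3 |z - 1| as soon as |z - 1| <= 1. *)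
move=> L0 hL hP2 S eps eps0; pose d := Num.min 1 (eps / 3).
have d0 : 0 < d by rewrite lt_min ltr01 divr_gt0.
have d1 : d <= 1 by rewrite ge_min lexx.
have d3 : 3 * d <= eps by rewrite mulrC -ler_pdivlMr // ge_min lexx orbT.
have [xi xi1 hxi] := approximate_units Hcomm Hhaar Hnorm S hP2 d0.
pose w := coefv Hcomm Hhaar Hnorm xi xi.
have Nw : N w <= 1 by exact: norm_coef xi1.
have Nw0 : 0 <= N w by exact: norm_ge0 Hreg _ (A_fsf w).
exists (mulv w w); [split|].
- apply: le_trans (balg_normM Hreg (A_fsf w) (A_fsf w)) _.
  by rewrite -[leRHS]mulr1; exact: ler_pM.
- move=> m K s K0 hm us su.
  have sw : supported s w by move=> x wx; apply: su; rewrite mulf_neq0.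
  apply: le_trans (hL m K K0 hm w w s us sw sw) _.
  rewrite -mulrA -[leRHS]mulr1 ler_wpM2l ?mulr_ge0 //.
  by rewrite -[leRHS]mulr1; exact: ler_pM.
- move=> x xS; have := hxi x xS; rewrite -[mulv w w x]/(w x * w x) -[coef _ _ _ _ _ x]/(w x).
  move: (w x) => z hz.
  have -> : z * z - 1 = (z - 1) * (z - 1) + (z - 1) *+ 2 by ring.
  apply: le_lt_trans (le_normcD _ _) _; rewrite normcM normcMn.
  have z0 := normc_ge0 (z - 1).
  have : normc (z - 1) * normc (z - 1) <= normc (z - 1).
    by rewrite -[leRHS]mulr1 ler_wpM2l //; apply: ltW (lt_le_trans hz d1).
  by move: hz d3; lra.
Qed.

(** * Implementing a derivation along an ultrafilter of approximate units *)

Section Derivation.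
Variables (L : R) (U : set_system V).
Hypothesis UU : UltraFilter U.
Hypothesis U_good : U (good_unit L).
Hypothesis U_near : forall (S : seq H) (eps : R), 0 < eps ->
  U [set u : V | forall x, x \in S -> normc (u x - 1) < eps].

Variables (X : completeNormedModType C).
Variables (l : (H -> C) -> X -> X) (r : X -> (H -> C) -> X).
Variable D : (H -> C) -> X -> C.
Hypothesis Hbi : banach_bimodule A N l r.
Hypothesis HD : dual_derivation A N l r D.

(** The norm of [X] is complex valued; [nX] serves to state real inequalities. *)
Definition nX (v : X) : R := complex.Re `|v|.

Lemma nXE v : `|v| = (nX v)%:C.
Proof.
have : 0 <= `|v| by exact: normr_ge0.
by rewrite /nX; case: `|v| => a b; rewrite lecE /= => /andP[/eqP -> _].
Qed.

Lemma nX_ge0 v : 0 <= nX v.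
Proof. by have : 0 <= `|v| by []; rewrite nXE lecR. Qed.

Lemma action_bounds : exists2 M : R, 0 <= M & forall a v, A a ->
  [/\ nX (l a v) <= M * N a * nX v, nX (r v a) <= M * N a * nX v
    & normc (D a v) <= M * N a * nX v].
Proof.
have [M1 h1] := bimod_bounded Hbi; have [M2 h2] := dder_bounded HD.
exists (`|M1| + `|M2|); first by rewrite addr_ge0.
move=> a v Aa; have Na := norm_ge0 Hreg Aa; have nv := nX_ge0 v.
have [] := h1 a v Aa; rewrite !nXE -!rmorphM !lecR => hl hr.
have := h2 a v Aa; rewrite -[`|D a v|]/((normc (D a v))%:C) nXE -!rmorphM !lecR => hD.
have le1 : M1 <= `|M1| + `|M2| by apply: le_trans (ler_norm _) _; rewrite lerDl.
have le2 : M2 <= `|M1| + `|M2| by apply: le_trans (ler_norm _) _; rewrite lerDr.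
have w M : M <= `|M1| + `|M2| -> M * N a * nX v <= (`|M1| + `|M2|) * N a * nX v.
  by move=> hM; rewrite ler_wpM2r // ler_wpM2r.
by split; [apply: le_trans hl _|apply: le_trans hr _|apply: le_trans hD _]; exact: w.
Qed.

Let M := sval (cid2 action_bounds).
Let M_ge0 : 0 <= M := let: exist2 _ h _ as p := cid2 action_bounds return 0 <= sval p in h.
Let M_bounds : forall a v, A a ->
  [/\ nX (l a v) <= M * N a * nX v, nX (r v a) <= M * N a * nX v
    & normc (D a v) <= M * N a * nX v].
Proof. by rewrite /M; case: cid2. Qed.

Lemma D_bound a v : A a -> normc (D a v) <= M * N a * nX v.
Proof. by move=> Aa; have [] := M_bounds v Aa. Qed.

Lemma Dr_bound a b v : A a -> A b -> normc (D a (r v b)) <= M * M * N a * N b * nX v.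
Proof.
move=> Aa Ab; apply: le_trans (D_bound _ Aa) _.
have [_ h _] := M_bounds v Ab.
have -> : M * M * N a * N b * nX v = M * N a * (M * N b * nX v) by ring.
by rewrite ler_wpM2l // mulr_ge0 ?(norm_ge0 Hreg).
Qed.

Lemma D_linear_vec a (c : C) v w : A a -> D a (c *: v + w) = c * D a v + D a w.
Proof. by move=> /(dder_dual HD)[h _]; exact: h. Qed.

Lemma D0_vec a : A a -> D a 0 = 0.
Proof.
move=> Aa; have := D_linear_vec 1 0 0 Aa; rewrite scale1r addr0 mul1r.
by rewrite -[LHS]addr0 => /addrI.
Qed.

Lemma D_scale_vec a (c : C) v : A a -> D a (c *: v) = c * D a v.
Proof. by move=> Aa; have := D_linear_vec c v 0 Aa; rewrite !addr0 D0_vec // addr0. Qed.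

Lemma D_sub_vec a v w : A a -> D a (v - w) = D a v - D a w.
Proof.
move=> Aa; have := D_linear_vec (-1) w v Aa.
by rewrite scaleN1r mulN1r addrC => ->; rewrite addrC.
Qed.

Lemma D_scale (c : C) a v : A a -> D (c *: a) v = c * D a v.
Proof.
move=> Aa; have A0 := balg0 Hreg.
have D0 : D 0 v = 0.
  have := dder_linear HD 1 v A0 A0; rewrite scale1r addr0 mul1r.
  by rewrite -[LHS]addr0 => /addrI.
by have := dder_linear HD c v Aa A0; rewrite !addr0 D0 addr0.
Qed.

Lemma D_sub a b v : A a -> A b -> D (a - b) v = D a v - D b v.
Proof.
by move=> Aa Ab; have := dder_linear HD (-1) v Ab Aa; rewrite scaleN1r mulN1r addrC => ->; rewrite addrC.
Qed.

Lemma r_scale (c : C) a v : A a -> r v (c *: a) = c *: r v a.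
Proof.
move=> Aa; have A0 := balg0 Hreg.
have r0 : r v 0 = 0.
  have := bimod_linear_r Hbi 1 v A0 A0; rewrite !scale1r addr0.
  by rewrite -[LHS]addr0 => /addrI.
by have := bimod_linear_r Hbi c v Aa A0; rewrite !addr0 r0 addr0.
Qed.

Lemma r_sub a b v : A a -> A b -> r v (a - b) = r v a - r v b.
Proof.
by move=> Aa Ab; have := bimod_linear_r Hbi (-1) v Ab Aa; rewrite !scaleN1r addrC => ->; rewrite addrC.
Qed.

Lemma r_delta_sum (s : seq H) (f : H -> C) v :
  r v (\sum_(x <- s) f x *: (delta x : H -> C)) = \sum_(x <- s) f x *: r v (delta x).
Proof.
elim: s => [|x s IH]; first by rewrite !big_nil -(scale0r 0) r_scale ?scale0r //; exact: balg0 Hreg.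
rewrite !big_cons -IH (bimod_linear_r Hbi) //; apply: (A_sum Hreg) => y.
by apply: (A_scale Hreg); exact: A_delta.
Qed.

Lemma D_delta_sum (s : seq H) (f : H -> C) v :
  D (\sum_(x <- s) f x *: (delta x : H -> C)) v = \sum_(x <- s) f x * D (delta x) v.
Proof.
elim: s => [|x s IH]; first by rewrite !big_nil -(scale0r 0) D_scale ?mul0r //; exact: balg0 Hreg.
rewrite !big_cons -IH (dder_linear HD) //; apply: (A_sum Hreg) => y.
by apply: (A_scale Hreg); exact: A_delta.
Qed.

Lemma D_vec_sum (s : seq H) (f : H -> C) (w : H -> X) a : A a ->
  D a (\sum_(x <- s) f x *: w x) = \sum_(x <- s) f x * D a (w x).
Proof.
move=> Aa; elim: s => [|x s IH]; first by rewrite !big_nil D0_vec.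
by rewrite !big_cons D_linear_vec // IH.
Qed.

(** This is the matrix of (a, b) |-> D b (v . a), a form to which the bound in [good_unit] can be
    applied. *)
Lemma D_matrix_bounded v :
  bform_bounded N (fun x y => D (delta y) (r v (delta x))) (M * M * nX v).
Proof.
move=> a b s us sa sb.
have -> : \sum_(x <- s) \sum_(y <- s) a x * b y * D (delta y) (r v (delta x)) = D b (r v a).
  rewrite [in r v a](fsf_delta us sa) r_delta_sum D_vec_sum; last exact: A_fsf.
  apply: eq_bigr => x _; rewrite [in RHS](fsf_delta us sb) D_delta_sum mulr_sumr.
  by apply: eq_bigr => y _; rewrite mulrA.
apply: le_trans (Dr_bound v (A_fsf b) (A_fsf a)) _.
by rewrite le_eqVlt; apply/orP; left; apply/eqP; ring.
Qed.

(** For a diagonal with terms a_i (x) b_i, the classical implementing functional is the sum of the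
    a_i . D b_i; here the terms are u(x) delta_x (x) delta_x. *)
Definition diag_pairing (u : V) (v : X) : C :=
  \sum_(x \in [set: H]) u x * D (delta x) (r v (delta x)).

Lemma diag_pairingE (u : V) v s : uniq s -> supported s u ->
  diag_pairing u v = \sum_(x <- s) u x * D (delta x) (r v (delta x)).
Proof.
move=> us su; apply: fsum_seq => // x; rewrite mulf_eq0 negb_or => /andP[/su //].
Qed.

Lemma diag_pairing_bound u v : good_unit L u ->
  normc (diag_pairing u v) <= L * (M * M) * nX v.
Proof.
move=> [_ hu]; have [s us su] := fsf_support u; rewrite (diag_pairingE _ us su) -mulrA.
apply: (hu (fun x y => D (delta y) (r v (delta x)))) => //; last exact: D_matrix_bounded.
by rewrite !mulr_ge0 ?nX_ge0.
Qed.

Lemma diag_pairing_linear u (c : C) v w :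
  diag_pairing u (c *: v + w) = c * diag_pairing u v + diag_pairing u w.
Proof.
have [s us su] := fsf_support u; rewrite !(diag_pairingE _ us su).
rewrite mulr_sumr -big_split; apply: eq_bigr => x _ /=.
by rewrite (bimod_r_linear Hbi (A_delta x)) (D_linear_vec _ _ _ (A_delta x)); ring.
Qed.

Lemma delta_mul (a : H -> C) x : (delta x : H -> C) * a = a x *: (delta x : H -> C).
Proof.
apply/funext => y; rewrite -[LHS]/(delta x y * a y) -[RHS]/(a x * delta x y) deltaE.
by have [->|] := eqVneq y x; rewrite ?mulr1 ?mul1r ?mulr0 ?mul0r.
Qed.

Lemma fct_mulC (a b : H -> C) : a * b = b * a.
Proof. by apply/funext => y; rewrite -[LHS]/(a y * b y) mulrC. Qed.

(** Exact term by term: delta_x a = a(x) delta_x, so for w = v . delta_x the Leibniz rule reads a(x)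
    D delta_x w = D a w + D delta_x (a . w). *)
Lemma diag_pairing_commutator u a v : A a ->
  diag_pairing u (r v a) - diag_pairing u (l a v) = D a (r v u).
Proof.
move=> Aa; have [s us su] := fsf_support u; rewrite !(diag_pairingE _ us su).
rewrite [in RHS](fsf_delta us su) r_delta_sum D_vec_sum // -sumrB.
apply: eq_bigr => x _; rewrite -mulrBr; congr (_ * _).
set w := r v (delta x).
have -> : r (r v a) (delta x) = a x *: w.
  by rewrite -(bimod_rM Hbi) // fct_mulC delta_mul r_scale.
have -> : r (l a v) (delta x) = l a w by rewrite (bimod_lr Hbi).
have := dder_leibniz HD w (A_delta x) Aa.
have -> : r w (delta x) = w.
  by rewrite /w -(bimod_rM Hbi) // delta_mul deltaE eqxx scale1r.
by rewrite delta_mul D_scale // D_scale_vec // => ->; rewrite addrK.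
Qed.

Lemma unit_near_fsf (f : V) (eps : R) : 0 < eps ->
  U [set u : V | N ((f : H -> C) * u - f) < eps].
Proof.
move=> eps0; have [s us hs] := fsf_support f.
pose B := \sum_(x <- s) normc (f x) * N (delta x).
have B0 : 0 <= B.
  by rewrite sumr_ge0 // => x _; rewrite mulr_ge0 ?normc_ge0 ?(norm_ge0 Hreg).
have B1 : 0 < B + 1 by rewrite ltr_wpDl.
have d0 : 0 < eps / (B + 1) by rewrite divr_gt0.
apply: filterS (U_near s d0) => u /= hu.
have -> : (f : H -> C) * u - f = \sum_(x <- s) (f x * (u x - 1)) *: (delta x : H -> C).
  have su : forall x, mulv f (fun y => u y - 1) x != 0 -> x \in s.
    by move=> x; rewrite mulf_eq0 negb_or => /andP[/hs].
  rewrite -(fsf_delta us su); apply/funext => x.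
  by rewrite -[LHS]/(f x * u x - f x) -[RHS]/(f x * (u x - 1)) mulrBr mulr1.
apply: le_lt_trans (norm_sum_le Hreg s _) _.
  by move=> x; apply: (A_scale Hreg); exact: A_delta.
apply: (@le_lt_trans _ _ (B * (eps / (B + 1)))).
  rewrite mulr_suml !big_seq; apply: ler_sum => x xs.
  rewrite (balg_normZ Hreg _ (A_delta x)) normcM mulrAC.
  apply: ler_wpM2l; last exact: ltW (hu x xs).
  by rewrite mulr_ge0 ?normc_ge0 ?(norm_ge0 Hreg).
by rewrite mulrA ltr_pdivrMr // mulrC ltr_pM2l // ltrDl.
Qed.

(** The bound [N u <= 1] of good units extends the convergence from the dense finitely supported
    functions to the whole algebra. *)
Lemma unit_near a (eps : R) : A a -> 0 < eps -> U [set u : V | N (a * u - a) < eps].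
Proof.
move=> Aa eps0; have e3 : 0 < eps / 3 by rewrite divr_gt0.
have [f hf] := A_density Hcomm Hhaar Hnorm Aa e3.
apply: filterS2 U_good (unit_near_fsf f e3) => u [u1 _] /= hu.
have Au := A_fsf u; have Af := A_fsf f.
have Afu : A ((f : H -> C) * u) by exact: (balg_mul Hreg).
have Aaf : A (a - f) by exact: A_sub.
have -> : a * u - a = (a - f) * u + ((f : H -> C) * u - f) + - (a - f).
  apply/funext => x.
  rewrite -[LHS]/(a x * u x - a x) -[RHS]/((a x - f x) * u x + (f x * u x - f x) - (a x - f x)); ring.
apply: le_lt_trans (balg_normD Hreg _ _) _.
- by apply: (A_add Hreg); [exact: (balg_mul Hreg)|exact: A_sub].
- exact: (A_opp Hreg).
rewrite (norm_opp Hreg) //.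
apply: le_lt_trans (lerD (balg_normD Hreg (balg_mul Hreg Aaf Au) (A_sub Afu Af)) (lexx _)) _.
have h : N ((a - f) * u) < eps / 3.
  apply: le_lt_trans hf; apply: le_trans (balg_normM Hreg Aaf Au) _.
  by rewrite -[leRHS]mulr1; apply: ler_wpM2l => //; exact: norm_ge0 Hreg _ Aaf.
have -> : eps = eps / 3 + eps / 3 + eps / 3 by field.
exact: ltrD (ltrD h hu) hf.
Qed.

(* [X] need not be essential: [phi] implements [D] as far as it is seen through
   the limits of [v . u], and [theta - theta_ess], which vanishes on [X . A],
   accounts for the rest. *)
Definition theta v : C := LIM U (fun u => D u v).
Definition phi v : C := LIM U (fun u => diag_pairing u v).
Definition theta_ess v : C := LIM U (fun u => theta (r v u)).

Lemma ubounded_D v : ubounded U (fun u => D u v) (M * nX v).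
Proof.
apply: filterS U_good => u [u1 _] /=; apply: le_trans (D_bound _ (A_fsf u)) _.
rewrite ler_wpM2r ?nX_ge0 // -[leRHS]mulr1; exact: ler_wpM2l.
Qed.

Lemma theta_bound v : normc (theta v) <= M * nX v.
Proof. by rewrite /theta; exact: (LIM_bound UU (ubounded_D v)). Qed.

Lemma theta_linear (c : C) v w : theta (c *: v + w) = c * theta v + theta w.
Proof.
rewrite -(LIM_linear UU _ (ubounded_D v) (ubounded_D w)); congr LIM.
by apply/funext => u; rewrite D_linear_vec.
Qed.

Lemma theta_sub v w : theta (v - w) = theta v - theta w.
Proof.
have := theta_linear (-1) w v.
by rewrite scaleN1r mulN1r addrC => ->; rewrite addrC.
Qed.

Lemma ubounded_diag v : ubounded U (fun u => diag_pairing u v) (L * (M * M) * nX v).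
Proof. by apply: filterS U_good => u gu /=; exact: diag_pairing_bound. Qed.

Lemma phi_linear (c : C) v w : phi (c *: v + w) = c * phi v + phi w.
Proof.
rewrite -(LIM_linear UU _ (ubounded_diag v) (ubounded_diag w)); congr LIM.
by apply/funext => u; rewrite diag_pairing_linear.
Qed.

Lemma theta_r_bound a v : A a -> normc (theta (r v a)) <= M * M * N a * nX v.
Proof.
move=> Aa; apply: le_trans (theta_bound _) _; have [_ h _] := M_bounds v Aa.
by rewrite -!mulrA ler_wpM2l // mulrA.
Qed.

Lemma ubounded_theta_r v : ubounded U (fun u => theta (r v u)) (M * M * nX v).
Proof.
apply: filterS U_good => u [u1 _] /=; apply: le_trans (theta_r_bound v (A_fsf u)) _.
by rewrite ler_wpM2r ?nX_ge0 // -[leRHS]mulr1 ler_wpM2l ?mulr_ge0.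
Qed.

Lemma theta_ess_linear (c : C) v w : theta_ess (c *: v + w) = c * theta_ess v + theta_ess w.
Proof.
rewrite -(LIM_linear UU _ (ubounded_theta_r v) (ubounded_theta_r w)); congr LIM.
by apply/funext => u; rewrite (bimod_r_linear Hbi (A_fsf u)) theta_linear.
Qed.

Lemma ulim_small (f : V -> C) (g : V -> R) (lim : C) (B : R) : 0 <= B ->
  (forall u, good_unit L u -> normc (f u - lim) <= B * g u) ->
  (forall eps : R, 0 < eps -> U [set u | g u < eps]) -> LIM U f = lim.
Proof.
move=> B0 hf hg; apply: (LIM_eq UU) => eps eps0.
have B1 : 0 < B + 1 by rewrite ltr_wpDl.
have d0 : 0 < eps / (B + 1) by rewrite divr_gt0.
apply: filterS2 U_good (hg _ d0) => u gu /= h; apply: le_lt_trans (hf u gu) _.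
apply: le_lt_trans (ler_wpM2l B0 (ltW h)) _.
by rewrite mulrA ltr_pdivrMr // mulrC ltr_pM2l // ltrDl.
Qed.

Lemma LIM_D_r_mul a b v : A a -> A b -> LIM U (fun u => D a (r (r v b) u)) = D a (r v b).
Proof.
move=> Aa Ab; have Na := norm_ge0 Hreg Aa.
apply: (@ulim_small _ (fun u => N (b * u - b)) _ (M * M * N a * nX v)).
- by rewrite !mulr_ge0 ?nX_ge0.
- move=> u _; have Abu : A (b * u) by exact: (balg_mul Hreg).
  rewrite -(bimod_rM Hbi) //.
  have -> : D a (r v (b * u)) - D a (r v b) = D a (r v (b * u - b)).
    by rewrite r_sub // D_sub_vec.
  apply: le_trans (Dr_bound v Aa (A_sub Abu Ab)) _.
  by rewrite -!mulrA [nX v * _]mulrC.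
- by move=> eps; exact: unit_near.
Qed.

Lemma LIM_D_r a v : A a -> phi (r v a) - phi (l a v) = LIM U (fun u => D a (r v u)).
Proof.
move=> Aa; have := LIM_linear UU (-1) (ubounded_diag (l a v)) (ubounded_diag (r v a)).
rewrite mulN1r addrC => <-; congr LIM; apply/funext => u.
by rewrite mulN1r addrC diag_pairing_commutator.
Qed.

Lemma ubounded_D_r a v : A a -> ubounded U (fun u => D a (r v u)) (M * M * N a * nX v).
Proof.
move=> Aa; have Na := norm_ge0 Hreg Aa.
apply: filterS U_good => u [u1 _] /=; apply: le_trans (Dr_bound v Aa (A_fsf u)) _.
by rewrite ler_wpM2r ?nX_ge0 // -[leRHS]mulr1 ler_wpM2l ?mulr_ge0.
Qed.

(** The Leibniz rule for the product u a, in the limit where u a tends to a. *)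
Lemma D_split a v : A a -> D a v = LIM U (fun u => D a (r v u)) + theta (l a v).
Proof.
move=> Aa.
have := LIM_linear UU 1 (ubounded_D_r v Aa) (ubounded_D (l a v)).
rewrite mul1r -/(theta _) => <-; apply/esym.
apply: (@ulim_small _ (fun u => N (a * u - a)) _ (M * nX v)).
- by rewrite mulr_ge0 ?nX_ge0.
- move=> u _; have Au := A_fsf u; have Aau : A (a * u) by exact: (balg_mul Hreg).
  rewrite mul1r -(dder_leibniz HD v Au Aa) fct_mulC -D_sub //.
  by apply: le_trans (D_bound _ (A_sub Aau Aa)) _; rewrite mulrAC.
- by move=> eps; exact: unit_near.
Qed.

Lemma theta_ess_r a v : A a -> theta_ess (r v a) = theta (r v a).
Proof.
move=> Aa; apply: (@ulim_small _ (fun u => N (a * u - a)) _ (M * M * nX v)).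
- by rewrite !mulr_ge0 ?nX_ge0.
- move=> u _; have Aau : A (a * u) by exact: (balg_mul Hreg).
  rewrite -(bimod_rM Hbi) //.
  have -> : theta (r v (a * u)) - theta (r v a) = theta (r v (a * u - a)).
    by rewrite r_sub // theta_sub.
  by apply: le_trans (theta_r_bound v (A_sub Aau Aa)) _; rewrite mulrAC.
- by move=> eps; exact: unit_near.
Qed.

(** At v . u, the limit in [D_split] is D a (v . u) itself because v . u lies in X . A. So theta
    vanishes on a . (v . u) already before the outer limit. *)
Lemma theta_ess_l a v : A a -> theta_ess (l a v) = 0.
Proof.
move=> Aa; rewrite /theta_ess -[RHS](LIM_cst UU 0); congr LIM; apply/funext => u.
have Au := A_fsf u.
rewrite (bimod_lr Hbi) //; have := D_split (r v u) Aa.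
rewrite LIM_D_r_mul // -[LHS]addr0 => /addrI <-; by [].
Qed.

Lemma derivation_inner : exists2 psi : X -> C, bounded_functional psi &
  forall a v, A a -> D a v = psi (r v a) - psi (l a v).
Proof.
(* [D_split] and [LIM_D_r] give D a v = phi (v . a) - phi (a . v) + theta (a . v). The correction
   theta - theta_ess vanishes on v . a and equals theta on a . v, which absorbs the last term. *)
exists (fun v => phi v - (theta v - theta_ess v)).
  split=> [c v w|].
    by rewrite phi_linear theta_linear theta_ess_linear; ring.
  exists (L * (M * M) + (M + M * M)) => v.
  rewrite -[`|_ - _|]/((normc _)%:C) nXE -rmorphM lecR.
  apply: le_trans (le_normcD _ _) _; rewrite normcN.
  have h1 := LIM_bound UU (ubounded_diag v).
  have h2 := theta_bound v; have h3 := LIM_bound UU (ubounded_theta_r v).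
  have h4 : normc (theta v - theta_ess v) <= normc (theta v) + normc (theta_ess v).
    by rewrite -[normc (theta_ess v)]normcN; exact: le_normcD.
  rewrite /phi /theta_ess in h1 h3 h4 *; lra.
move=> a v Aa; rewrite theta_ess_r // theta_ess_l // subrr !subr0.
have -> : phi (r v a) - (phi (l a v) - theta (l a v)) =
  phi (r v a) - phi (l a v) + theta (l a v) by ring.
by rewrite LIM_D_r // -D_split.
Qed.

End Derivation.

Lemma amenable_of_diagonal L : 0 <= L ->
  (forall m K, 0 <= K -> bform_bounded N m K ->
     dform_bounded N (fun x => m x x) (L * K)) ->
  property_P2 lam -> amenable A N.
Proof.
move=> L0 hL hP2 X l r Hbi D HD.
(* The filter generated by the good units close to 1 on a finite set is proper by [good_unit_near];
   an ultrafilter containing it makes all the bounded quantities converge. *)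
pose F : set_system V := [set P | exists (S : seq H) (eps : R), 0 < eps /\
  forall u, good_unit L u -> (forall x, x \in S -> normc (u x - 1) < eps) -> P u].
have FF : ProperFilter F.
  apply: Build_ProperFilter_ex => [P [S [eps [eps0 hP]]]|].
    by have [u gu hu] := good_unit_near L0 hL hP2 S eps0; exists u; exact: hP.
  split=> [|P Q [S [e [e0 hP]]] [S' [e' [e'0 hQ]]]|P Q PQ [S [e [e0 hP]]]].
  - by exists [::], 1; split.
  - exists (S ++ S'), (Num.min e e'); split; first by rewrite lt_min e0.
    move=> u gu hu; split; [apply: hP|apply: hQ] => // x xS.
      by have := hu x; rewrite mem_cat xS => /(_ isT); rewrite lt_min => /andP[].
    by have := hu x; rewrite mem_cat xS orbT => /(_ isT); rewrite lt_min => /andP[].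
  - by exists S, e; split=> // u gu hu; apply/PQ/hP.
have [U [UU FU]] := ultraFilterLemma FF.
have Ug : U (good_unit L) by apply: FU; exists [::], 1; split.
apply: (derivation_inner UU Ug _ Hbi HD) => S eps eps0.
by apply: FU; exists S, eps; split.
Qed.

End Amenability.

Theorem theorem4p4 (R : realType) (H : discreteHypergroup R) (lam : H -> R)
    (Hcomm : hcommutative H)
    (Hhaar : left_haar lam)
    (Hnorm : lam (hunit H) = 1)
    (Hreg : regular_fourier lam)
    (HP2 : property_P2 lam)
    (HB : B_space (prod_haar lam lam) = Blam_space (prod_haar lam lam))
    (Hfin : finite_set (range lam)) :
  banach_algebra (A_space lam) (Blam_norm lam) /\
  amenable (A_space lam) (Blam_norm lam).
Proof.
split; first exact: Hreg.
have [cs _ hcs] := finite_set_seq Hfin.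
have AV (f : fsf H R) : A_space lam f by exact: (A_fsf Hcomm Hhaar Hnorm Hreg).
have [||| L L0 hL] := @diagonal_interpolation _ _ _ Hcomm Hhaar Hnorm (Blam_norm lam) _ _ _ cs.
- by move=> f; exact: (norm_ge0 Hreg (AV f)).
- by move=> f g; exact: (balg_normM Hreg (AV f) (AV g)).
- by move=> u u1; apply: norm_coef; rewrite u1.
apply: (amenable_of_diagonal Hcomm Hhaar Hnorm Hreg L0) => // m K K0 hm.
apply: dform_ext (hL m K K0 hm) => x.
have : lam x \in cs by apply: hcs; exists x.
move=> xcs; have -> : \prod_(c <- cs) (1 - c / lam x) = 0; last by rewrite subr0 mulr1.
apply/eqP; rewrite prodf_seq_eq0; apply/hasP; exists (lam x) => //=.
by rewrite divff ?subrr // lt0r_neq0 // (lam_gt0 Hhaar Hnorm).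
Qed.
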